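(* Let assumptions (A1) and (A2b) be satisfied and assume that $\kappa^2>0$. For any sequence $a_{N,T}\ge e$ choose $\lambda_{N,T}=\sqrt{4NT\log(p)^3\log(a_{N,T})^3}$ and $\mu_{N,T}=\sqrt{4T\log(N)^3\log(a_{N,T})^3}$. Let $$t=\frac{\kappa^2}{(s_1+s_2)\left(\frac{\log p}{\log N}\vee\frac{\log N}{\log p}\right)^3}$$ and suppose $Nt^2\ge1$. Then $$P(\mathcal{A}_{N,T}\cap\mathcal{B}_{N,T})\ge1-Ap^{1-B\log(a_{N,T})}-AN^{1-B\log(a_{N,T})}-A(p^2+Np)e^{-B(t^2N)^{1/3}}$$ for absolute constants $A$ and $B$. Furthermore, with at least this probability (namely on $\mathcal{A}_{N,T}\cap\mathcal{B}_{N,T}$), $$\|\hat\beta-\beta^*\|\le\frac{\xi_{N,T}}{\sqrt{NT}}\qquad\text{and}\qquad\|\hat c-c^*\|\le\frac{\xi_{N,T}}{\sqrt T},$$ where $\xi_{N,T}=16\log(a_{N,T})^{3/2}\left[\log(p)^{3/2}\sqrt{s_1}+\log(N)^{3/2}\sqrt{s_2}\right]/\kappa^2$.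
   Context: Model: for $i=1,\dots,N$, $t=1,\dots,T$, $y_{i,t}=x_{i,t}'\beta^*+c_i^*+\epsilon_{i,t}$ with random covariates $x_{i,t}=(x_{i,t,1},\dots,x_{i,t,p})'\in\mathbb{R}^p$, unknown deterministic vectors $\beta^*\in\mathbb{R}^p$, $c^*\in\mathbb{R}^N$ and random errors $\epsilon_{i,t}$; $p,N\ge e$. Put $X_i=(x_{i,1},\dots,x_{i,T})'$, $X=(X_1',\dots,X_N')'$, $\epsilon_i=(\epsilon_{i,1},\dots,\epsilon_{i,T})'$, $\epsilon=(\epsilon_1',\dots,\epsilon_N')'$, $y$ stacked in the same way, $D=I_N\otimes\iota$ with $\iota$ the $T\times1$ vector of ones, $Z=(X,D)$, $\gamma^*=({\beta^*}',{c^*}')'$, so $y=Z\gamma^*+\epsilon$. Let $s_1=|\{j:\beta_j^*\ne0\}|$, $s_2=|\{i:c_i^*\neq0\}|$. $\|\cdot\|$, $\|\cdot\|_{\ell_1}$, $\|\cdot\|_{\ell_\infty}$ are the $\ell_2$-, $\ell_1$- and $\ell_\infty$-norms; $a\vee b=\max(a,b)$; $\log$ is the natural logarithm; $v_A$ is the subvector of $v$ indexed by $A$. Panel Lasso: $\hat\gamma=(\hat\beta',\hat c')'$ minimizes $\|y-Z\gamma\|^2+2\lambda_{N,T}\|\beta\|_{\ell_1}+2\mu_{N,T}\|c\|_{\ell_1}$ over $\gamma=(\beta',c')'\in\mathbb{R}^{p+N}$. Restricted eigenvalues: let $S=\mathrm{diag}(\sqrt{NT}\,I_p,\sqrt T\,I_N)$,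 $\Psi_{N,T}=S^{-1}Z'ZS^{-1}$ and $\Gamma=\mathrm{diag}(E(X'X/(NT)),I_N)$ (block diagonal). For a positive semi-definite $(p+N)\times(p+N)$ matrix $M$ let $\kappa_M^2(r_1,r_2)$ be the minimum of $\delta'M\delta/\|\delta\|^2$ over all $\delta=({\delta^1}',{\delta^2}')'\in\mathbb{R}^{p+N}\setminus\{0\}$ ($\delta^1\in\mathbb{R}^p$, $\delta^2\in\mathbb{R}^N$) and all $R_1\subseteq\{1,\dots,p\}$, $R_2\subseteq\{1,\dots,N\}$ with $|R_1|\le r_1$, $|R_2|\le r_2$ and $\frac{\lambda_{N,T}}{\sqrt{NT}}\|\delta^1_{R_1^c}\|_{\ell_1}+\frac{\mu_{N,T}}{\sqrt T}\|\delta^2_{R_2^c}\|_{\ell_1}\le 3\frac{\lambda_{N,T}}{\sqrt{NT}}\|\delta^1_{R_1}\|_{\ell_1}+3\frac{\mu_{N,T}}{\sqrt T}\|\delta^2_{R_2}\|_{\ell_1}$. Write $\kappa^2=\kappa^2_\Gamma(s_1,s_2)$ and $\kappa^2_{\Psi_{N,T}}=\kappa^2_{\Psi_{N,T}}(s_1,s_2)$. Events: $\mathcal{A}_{N,T}=\{\|X'\epsilon\|_{\ell_\infty}\le\lambda_{N,T}/2,\ \|D'\epsilon\|_{\ell_\infty}\le\mu_{N,T}/2\}$, $\mathcal{B}_{N,T}=\{\kappa^2_{\Psi_{N,T}}\ge\kappa^2/2\}$. (A1): (a) $\{(X_i,\epsilon_i)\}_{i=1}^N$ are independent and identically distributed;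 (b) $X_i$ and $\epsilon_i$ are independent for each $i$; (c) for each $i$, $\{\epsilon_{i,t},\mathcal{F}_{i,t}\}_{t=1}^T$ with $\mathcal{F}_{i,t}=\sigma(\epsilon_{i,1},\dots,\epsilon_{i,t})$ is a martingale difference sequence ($E(\epsilon_{i,t}\mid\mathcal{F}_{i,t-1})=0$, $\mathcal F_{i,0}$ trivial). (A2b): $x_{1,t,k}$ and $\epsilon_{1,t}$ are uniformly subgaussian: there are constants $C,K>0$ with $P(|x_{1,t,k}|\ge u)\le\frac12Ke^{-Cu^2}$ and $P(|\epsilon_{1,t}|\ge u)\le\frac12Ke^{-Cu^2}$ for all $u>0$, $1\le t\le T$, $1\le k\le p$. The constants $C,K$ are regarded as fixed; ''absolute constants'' means positive constants that may depend on $C,K$ but on nothing else. *)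

(* Defs.v *)
From HB Require Import structures.
From mathcomp Require Import all_boot all_order all_algebra.
From mathcomp Require Import all_classical all_reals all_analysis.

Set Implicit Arguments.
Unset Strict Implicit.
Unset Printing Implicit Defensive.

Import Order.TTheory GRing.Theory Num.Theory.
Import numFieldNormedType.Exports.

Local Open Scope classical_set_scope.
Local Open Scope ring_scope.

(* The l_oo-norm is the library's [mx_norm]. *)

Definition l2norm (R : realType) (n : nat) (v : 'cV[R]_n) : R :=
  Num.sqrt (\sum_i v i 0 ^+ 2).

(* [l1norm_on A v] is the l1-norm of the subvector of [v] indexed by [A]. *)
Definition l1norm_on (R : realType) (n : nat) (A : {set 'I_n}) (v : 'cV[R]_n) : R :=
  \sum_(i in A) `|v i 0|.

Definition l1norm (R : realType) (n : nat) (v : 'cV[R]_n) : R :=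
  \sum_i `|v i 0|.

Definition sparsity (R : realType) (n : nat) (v : 'cV[R]_n) : nat :=
  #|[pred i | v i 0 != 0]|.

(* [mxvec] is row-major, so a panel (u_{i,t}) becomes the column
   (u_{1,1}, .., u_{1,T}, u_{2,1}, .., u_{N,T})'. *)
Definition stack (R : realType) (N T : nat) (u : 'I_N -> 'I_T -> R) :
    'cV[R]_(N * T) :=
  (mxvec (\matrix_(i, t) u i t))^T.

Definition covariate_mx (R : realType) (N T p : nat)
    (x : 'I_N -> 'I_T -> 'I_p -> R) : 'M[R]_(N * T, p) :=
  \matrix_(r, k) stack (fun i t => x i t k) r 0.

(* D = I_N (x) iota: column j is the stacked indicator of individual j. *)
Definition dummy_mx (R : realType) (N T : nat) : 'M[R]_(N * T, N) :=
  \matrix_(r, j) stack (fun i (_ : 'I_T) => (i == j)%:R) r 0.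

Definition design_mx (R : realType) (N T p : nat)
    (x : 'I_N -> 'I_T -> 'I_p -> R) : 'M[R]_(N * T, p + N) :=
  row_mx (covariate_mx x) (dummy_mx R N T).

Definition lasso_objective (R : realType) (N T p : nat) (lam mu : R)
    (x : 'I_N -> 'I_T -> 'I_p -> R) (y : 'I_N -> 'I_T -> R)
    (b : 'cV[R]_p) (c : 'cV[R]_N) : R :=
  l2norm (stack y - design_mx x *m col_mx b c) ^+ 2
  + 2 * lam * l1norm b + 2 * mu * l1norm c.

Definition is_panel_lasso (R : realType) (N T p : nat) (lam mu : R)
    (x : 'I_N -> 'I_T -> 'I_p -> R) (y : 'I_N -> 'I_T -> R)
    (bhat : 'cV[R]_p) (chat : 'cV[R]_N) : Prop :=
  forall (b : 'cV[R]_p) (c : 'cV[R]_N),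
    lasso_objective lam mu x y bhat chat <= lasso_objective lam mu x y b c.

Definition scaling_mx (R : realType) (N T p : nat) : 'M[R]_(p + N) :=
  block_mx (Num.sqrt (N%:R * T%:R))%:M 0 0 (Num.sqrt T%:R)%:M.

Definition Psi_mx (R : realType) (N T p : nat)
    (x : 'I_N -> 'I_T -> 'I_p -> R) : 'M[R]_(p + N) :=
  invmx (scaling_mx R N T p) *m (design_mx x)^T *m design_mx x
    *m invmx (scaling_mx R N T p).

Definition re_cone (R : realType) (N T p : nat) (lam mu : R)
    (d1 : 'cV[R]_p) (d2 : 'cV[R]_N) (R1 : {set 'I_p}) (R2 : {set 'I_N}) : Prop :=
  lam / Num.sqrt (N%:R * T%:R) * l1norm_on (~: R1) d1
    + mu / Num.sqrt T%:R * l1norm_on (~: R2) d2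
  <= 3 * (lam / Num.sqrt (N%:R * T%:R)) * l1norm_on R1 d1
    + 3 * (mu / Num.sqrt T%:R) * l1norm_on R2 d2.

(* For positive semi-definite M and lam, mu > 0 the infimum is attained (the
   quotient is homogeneous of degree 0 and the cone is closed) unless
   r1 = r2 = 0, in which case the set is empty, there is no minimum, and
   [inf] returns the default value 0. *)
Definition kappa2 (R : realType) (N T p : nat) (lam mu : R)
    (M : 'M[R]_(p + N)) (r1 r2 : nat) : R :=
  inf [set q : R | exists (d1 : 'cV[R]_p) (d2 : 'cV[R]_N)
        (R1 : {set 'I_p}) (R2 : {set 'I_N}),
      let d := col_mx d1 d2 in
      [/\ d != 0, (#|R1| <= r1)%N, (#|R2| <= r2)%N,
          re_cone T lam mu d1 d2 R1 R2 &
          q = (d^T *m M *m d) 0 0 / l2norm d ^+ 2]].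

Section Probability.
Context (d : measure_display) (Omega : measurableType d) (R : realType).
Context (P : probability Omega R).

Definition mutually_independent (d' : measure_display) (E : measurableType d')
    (I : finType) (W : I -> Omega -> E) : Prop :=
  forall (J : {set I}) (B : I -> set E), (forall i, measurable (B i)) ->
    P (\bigcap_(i in [set` J]) (W i @^-1` B i))
    = (\prod_(i in J) P (W i @^-1` B i))%E.

Definition identically_distributed (d' : measure_display)
    (E : measurableType d') (I : Type) (W : I -> Omega -> E) : Prop :=
  forall (i j : I) (B : set E), measurable B ->
    P (W i @^-1` B) = P (W j @^-1` B).

Definition independent_pair (d1 d2 : measure_display)
    (E1 : measurableType d1) (E2 : measurableType d2)
    (U : Omega -> E1) (V : Omega -> E2) : Prop :=
  forall (B1 : set E1) (B2 : set E2), measurable B1 -> measurable B2 ->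
    P ((U @^-1` B1) `&` (V @^-1` B2))
    = (P (U @^-1` B1) * P (V @^-1` B2))%E.

Definition sub_measurable (G : set (set Omega)) (f : Omega -> R) : Prop :=
  preimage_set_system setT f measurable `<=` G.

(* f is a version of E(g | G), for a sub-sigma-algebra G. *)
Definition is_cond_expectation (G : set (set Omega)) (g f : Omega -> R) : Prop :=
  [/\ sub_measurable G f, P.-integrable setT (EFin \o f) &
      forall A, G A -> (\int[P]_(w in A) (f w)%:E = \int[P]_(w in A) (g w)%:E)%E].

(* F s is the information after s periods; the element t of 'I_T is the
   (t+1)-th period. *)
Definition martingale_difference (T : nat) (F : nat -> set (set Omega))
    (e : 'I_T -> Omega -> R) : Prop :=
  forall t : 'I_T,
    [/\ sub_measurable (F t.+1) (e t), P.-integrable setT (EFin \o e t) &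
        is_cond_expectation (F t) (e t) (cst 0)].

Definition natural_filtration (T : nat) (e : 'I_T -> Omega -> R) (s : nat) :
    set (set Omega) :=
  <<s \bigcup_(t in [set t : 'I_T | (t < s)%N])
        preimage_set_system setT (e t) measurable >>.

Section Panel.
Context (N T p : nat).
Context (x : 'I_N -> 'I_T -> 'I_p -> {RV P >-> R}).
Context (eps : 'I_N -> 'I_T -> {RV P >-> R}).

Definition unit_covariates (i : 'I_N) (w : Omega) : T.-tuple (p.-tuple R) :=
  [tuple [tuple x i t k w | k < p] | t < T].

Definition unit_errors (i : 'I_N) (w : Omega) : T.-tuple R :=
  [tuple eps i t w | t < T].

Definition assumption_A1 : Prop :=
  [/\ mutually_independent (fun i w => (unit_covariates i w, unit_errors i w)),
      identically_distributed (fun i w => (unit_covariates i w, unit_errors i w)),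
      (forall i, independent_pair (unit_covariates i) (unit_errors i)) &
      (forall i, martingale_difference
         (natural_filtration (fun t => eps i t : Omega -> R))
         (fun t => eps i t))].

Definition assumption_A2b (C K : R) : Prop :=
  forall i : 'I_N, i = 0%N :> nat -> forall (u : R), 0 < u -> forall t : 'I_T,
    (forall k : 'I_p,
      (P [set w | (u <= `|x i t k w|)%R] <= (K / 2 * expR (- (C * u ^+ 2)))%:E)%E)
    /\ (P [set w | (u <= `|eps i t w|)%R] <= (K / 2 * expR (- (C * u ^+ 2)))%:E)%E.

Definition x_at (w : Omega) : 'I_N -> 'I_T -> 'I_p -> R := fun i t k => x i t k w.
Definition eps_at (w : Omega) : 'I_N -> 'I_T -> R := fun i t => eps i t w.

Definition Gamma_mx : 'M[R]_(p + N) :=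
  block_mx
    (\matrix_(j, k) fine 'E_P[fun w =>
       ((covariate_mx (x_at w))^T *m covariate_mx (x_at w)) j k / (N%:R * T%:R)])
    0 0 1%:M.

Definition event_A (lam mu : R) : set Omega :=
  [set w | mx_norm ((covariate_mx (x_at w))^T *m stack (eps_at w)) <= lam / 2 /\
           mx_norm ((dummy_mx R N T)^T *m stack (eps_at w)) <= mu / 2].

Definition event_B (lam mu : R) (s1 s2 : nat) : set Omega :=
  [set w | kappa2 T lam mu Gamma_mx s1 s2 / 2
             <= kappa2 T lam mu (Psi_mx (x_at w)) s1 s2].

End Panel.
End Probability.

(* Main.v *)
Require Import Defs.
From HB Require Import structures.
From mathcomp Require Import all_boot all_order all_algebra.
From mathcomp Require Import all_classical all_reals all_analysis.
From mathcomp Require Import measurable_realfun ring lra.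

Set Implicit Arguments.
Unset Strict Implicit.
Unset Printing Implicit Defensive.

Import Order.TTheory GRing.Theory Num.Theory.
Import numFieldNormedType.Exports.

Local Open Scope classical_set_scope.
Local Open Scope ring_scope.

(** Both claims rest on moment bounds for martingales and on the deterministic
analysis of the Lasso.

Deterministic part.  On the first event the noise terms X'e and D'e are
dominated by half the penalties, so comparing the Lasso objective at the
estimator and at the truth puts the rescaled error in the restricted cone and
bounds the prediction error by the penalized l1-norm on the supports.  On the
second event the restricted eigenvalue of the empirical matrix turns this into
a bound on the l2-norm of the error ([lasso_bound]).

Events.  In the cone the l1-norm is controlled by the l2-norm
([cone_l1norm]).  A quadratic form moves by at most the largest entrywise
perturbation times the squared l1-norm, so the second event holds as soon as
the empirical matrix is entrywise within t/32 of its population counterpart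
([kappa2_perturb], [Gamma_Psi_close]).  Since D'D/T is the identity, only
centred averages of products of covariates and averages of covariates have to
be controlled.  It remains to bound p + N + p^2 + Np tail probabilities.

Tails.  All of them are tails of sums S of n martingale increments whose
2m-th moments grow at most like (L m)^(2m): products of two subgaussian
variables in the worst case.  No conditional tail bound on the increments is
available, so the argument uses moments.  A pointwise inequality with the
linear term kept exact ([even_power_increment]), integrated along the
martingale, gives E S^(2m) <= (c m n)^m M, where M bounds the E X^(2m)
([even_moment_sum]).  Hence E S^(2m) <= (H m^3 n)^m k with constants H and k,
and Markov's inequality with m of order (u^2)^(1/3) yields
P(|S| > u sqrt n) <= A exp(-B u^(2/3)) ([moment_tail]).
With u^2 = log(p)^3 log(a)^3 this is a power of p, with u^2 of order N t^2 it
is exp(-B (t^2 N)^(1/3)).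

Orthogonality.  The only consequence of the martingale and independence
assumptions that enters is E[S^(2m-1) X] = 0, where X is the next increment
and S the sum of the preceding ones.  It is proved without conditional
expectations: if Z is orthogonal to the indicators 1_B(W) of a map W,
it is orthogonal to all functions of W ([orthogonal_extension]); powers of S are
expanded by the binomial theorem one summand at a time, and each factor split
off joins the function of the past that multiplies the increment
([indep_sum_orth], [unit_sum_orth]).

A probability is monotone on measurable sets only, so the second event, which
involves an infimum over uncountably many directions, has to be shown
measurable ([measurable_kappa2_ge]). *)

(** * Inequalities for powers *)

Section PowerInequalities.
Variable R : realType.
Implicit Types (a b x y : R).

(** A second-order Taylor bound.  Multiplying the remainder at exponent n by
    [a + b] gives the remainder at n + 1 up to the term [n a^(n-1) b^2]. *)
Lemma abs_taylor2 n a b :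
  `|(a + b) ^+ n - a ^+ n - n%:R * a ^+ n.-1 * b|
    <= n%:R ^+ 2 * b ^+ 2 * (`|a| + `|b|) ^+ n.-2.
Proof.
set s : R := `|a| + `|b|.
have s0 : 0 <= s by rewrite addr_ge0.
have as' : `|a| <= s by rewrite lerDl.
have abs' : `|a + b| <= s by exact: ler_normD.
have H n' : `|(a + b) ^+ n'.+2 - a ^+ n'.+2 - n'.+2%:R * a ^+ n'.+1 * b|
    <= n'.+2%:R ^+ 2 * b ^+ 2 * s ^+ n'.
  elim: n' => [|n' IH].
    have -> : (a + b) ^+ 2 - a ^+ 2 - 2 * a ^+ 1 * b = b ^+ 2 by ring.
    rewrite ger0_norm ?sqr_ge0// expr0 mulr1 ler_peMl ?sqr_ge0//; lra.
  have -> : (a + b) ^+ n'.+3 - a ^+ n'.+3 - n'.+3%:R * a ^+ n'.+2 * b =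
    (a + b) * ((a + b) ^+ n'.+2 - a ^+ n'.+2 - n'.+2%:R * a ^+ n'.+1 * b)
     + n'.+2%:R * a ^+ n'.+1 * b ^+ 2.
    by rewrite -(@natr1 R n'.+2) (exprS _ n'.+2) (exprS a n'.+2) (exprS a n'.+1); ring.
  apply: (le_trans (ler_normD _ _)).
  have h1 : `|(a + b) * ((a + b) ^+ n'.+2 - a ^+ n'.+2 - n'.+2%:R * a ^+ n'.+1 * b)|
     <= n'.+2%:R ^+ 2 * b ^+ 2 * s ^+ n'.+1.
    rewrite normrM (_ : _ * s ^+ n'.+1 = s * (n'.+2%:R ^+ 2 * b ^+ 2 * s ^+ n')).
      exact: ler_pM.
    by rewrite (exprS s n'); ring.
  have h2 : `|n'.+2%:R * a ^+ n'.+1 * b ^+ 2| <= n'.+2%:R * b ^+ 2 * s ^+ n'.+1.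
    rewrite normrM [`|_ * a ^+ _|]normrM normrX normr_nat.
    rewrite (ger0_norm (sqr_ge0 b)) mulrAC.
    by apply: ler_wpM2l; [rewrite mulr_ge0 ?sqr_ge0|apply: lerXn2r; rewrite ?nnegrE].
  apply: (le_trans (lerD h1 h2)).
  rewrite -!mulrDl; apply: ler_wpM2r; first exact: exprn_ge0.
  apply: ler_wpM2r; first exact: sqr_ge0.
  rewrite -(@natr1 R n'.+2); have : (0 : R) <= n'.+2%:R by []. nra.
case: n => [|[|n]] //.
  by rewrite !expr0 mul0r subrr mul0r subrr normr0 expr0n/= !mul0r.
rewrite /= !expr1 expr0 !mulr1 mul1r.
have -> : a + b - a - b = 0 by ring.
by rewrite normr0 expr1n mul1r sqr_ge0.
Qed.

(** A form of Young's inequality: whichever of [x] and [th * y] is larger, one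
    term on the right dominates. *)
Lemma mul_pow_young (m : nat) (th x y : R) : 0 < th -> 0 <= x -> 0 <= y ->
  x * y ^+ m <= th * y ^+ m.+1 + (th ^- m) * x ^+ m.+1.
Proof.
move=> th0 x0 y0; have [xy|yx] := leP x (th * y).
  rewrite exprS mulrA.
  apply: (@le_trans _ _ (th * y * y ^+ m)); first by rewrite ler_wpM2r ?exprn_ge0.
  by rewrite lerDl mulr_ge0 ?invr_ge0 ?exprn_ge0// ltW.
have : y <= x / th by rewrite ler_pdivlMr// mulrC ltW.
move=> h; apply: (@le_trans _ _ (x * (x / th) ^+ m)).
  by rewrite ler_wpM2l// lerXn2r// nnegrE divr_ge0// ltW.
have -> : x * (x / th) ^+ m = th ^- m * x ^+ m.+1.
  by rewrite expr_div_n (exprS x m); ring.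
by rewrite lerDr mulr_ge0 ?exprn_ge0// ltW.
Qed.

(** The same dichotomy, comparing [y] with [th * x]. *)
Lemma addr_pow_split (m : nat) (th x y : R) : 0 < th -> 0 <= x -> 0 <= y ->
  (x + y) ^+ m <= (1 + th) ^+ m * x ^+ m + (1 + th^-1) ^+ m * y ^+ m.
Proof.
move=> th0 x0 y0; have th0' := ltW th0; have [yx|xy] := leP y (th * x).
  rewrite -!exprMn -[leLHS]addr0; apply: lerD.
    rewrite lerXn2r ?nnegrE ?mulr_ge0 ?addr_ge0//.
    by rewrite mulrDl mul1r lerD2l.
  by rewrite exprn_ge0// mulr_ge0// addr_ge0// invr_ge0 ltW.
rewrite -!exprMn -[leLHS]add0r; apply: lerD.
  by rewrite exprn_ge0// mulr_ge0// addr_ge0.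
have h : x <= th^-1 * y by rewrite mulrC ler_pdivlMr// mulrC ltW.
have ti : 0 <= th^-1 by rewrite invr_ge0 ltW.
rewrite lerXn2r ?nnegrE ?mulr_ge0 ?addr_ge0//.
by rewrite mulrDl mul1r addrC lerD2l.
Qed.

Lemma expr_le_expR (x : R) (n : nat) : -1 <= x -> (1 + x) ^+ n <= expR (n%:R * x).
Proof.
move=> x1; rewrite expRM_natl lerXn2r ?nnegrE ?expR_ge0 ?expR_ge1Dx//; lra.
Qed.

(** The step from S to S + X in the moment bound, with a = S and b = X.  The
    linear term stays exact because its mean vanishes for martingale increments.
    Allowing a factor 1 + O(m/n) on [a^(2m)] makes n steps cost exp(O(m)) only,
    and the price on [b^(2m)] is then (O(m))^m n^(m-1).  This balance is what
    gives the factor (m n)^m, of the order of a Gaussian moment, after n steps. *)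
Lemma even_power_increment (m n : nat) a b : (0 < m)%N -> (m <= n)%N ->
  (a + b) ^+ (2 * m) <= (1 + 4 * expR 2 * (m%:R / n%:R)) * a ^+ (2 * m)
     + (2 * m)%:R * a ^+ (2 * m).-1 * b
     + 8 * m%:R ^+ 2 * (4 * m%:R) ^+ m * n%:R ^+ m.-1 * b ^+ (2 * m).
Proof.
case: m => // m _; set q := m.+1 => mn.
have n0 : (0 : R) < n%:R by rewrite ltr0n (leq_trans _ mn).
have q0 : (0 : R) < q%:R by rewrite ltr0n.
have qn : q%:R <= n%:R :> R by rewrite ler_nat.
have q1 : (1 : R) <= q%:R by rewrite ler1n.
set u : R := `|a| ^+ 2; set v : R := `|b| ^+ 2.
have u0 : 0 <= u by rewrite exprn_ge0.
have v0 : 0 <= v by rewrite exprn_ge0.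
have aE : a ^+ (2 * q) = u ^+ q by rewrite exprM -(real_normK (num_real a)).
have bE : b ^+ (2 * q) = v ^+ q by rewrite exprM -(real_normK (num_real b)).
set U : R := (1 + q%:R^-1) * u + (1 + q%:R) * v.
have iq0 : 0 < q%:R^-1 :> R by rewrite invr_gt0.
have U0 : 0 <= U by rewrite addr_ge0// mulr_ge0// addr_ge0// ltW.
have sU : (`|a| + `|b|) ^+ 2 <= U.
  rewrite /U /u /v -subr_ge0.
  rewrite (_ : _ - _ = q%:R^-1 * (`|a| - q%:R * `|b|) ^+ 2).
    by rewrite mulr_ge0 ?sqr_ge0// ltW.
  by field; rewrite gt_eqF.
have step1 : (a + b) ^+ (2 * q) <= a ^+ (2 * q) + (2 * q)%:R * a ^+ (2 * q).-1 * b
    + 4 * q%:R ^+ 2 * (v * U ^+ m).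
  have := abs_taylor2 (2 * q) a b; rewrite ler_norml => /andP[_].
  have -> : (2 * q)%:R ^+ 2 * b ^+ 2 * (`|a| + `|b|) ^+ (2 * q).-2 =
     4 * q%:R ^+ 2 * (v * ((`|a| + `|b|) ^+ 2) ^+ m).
    rewrite -exprM (_ : (2 * q).-2 = (2 * m)%N); last by rewrite /q mulnS.
    by rewrite natrM /v real_normK ?num_real//; ring.
  have : 4 * q%:R ^+ 2 * (v * ((`|a| + `|b|) ^+ 2) ^+ m) <=
         4 * q%:R ^+ 2 * (v * U ^+ m).
    rewrite ler_wpM2l ?mulr_ge0 ?exprn_ge0// ler_wpM2l//.
    by rewrite lerXn2r// nnegrE exprn_ge0// addr_ge0.
  lra.
have th0 : 0 < (q%:R * n%:R)^-1 :> R by rewrite invr_gt0 mulr_gt0.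
have step2 := mul_pow_young m th0 v0 U0.
have step3 : U ^+ q <= expR 2 * u ^+ q + (4 * q%:R ^+ 2) ^+ q * v ^+ q.
  apply: (@le_trans _ _ (((1 + q%:R^-1) * ((1 + q%:R^-1) * u)) ^+ q +
           ((1 + q%:R) * ((1 + q%:R) * v)) ^+ q)).
    have := @addr_pow_split q q%:R^-1 ((1 + q%:R^-1) * u) ((1 + q%:R) * v).
    rewrite invrK !exprMn; apply => //; rewrite mulr_ge0//; lra.
  have sq (x y : R) : (x * (x * y)) ^+ q = (x ^+ 2) ^+ q * y ^+ q.
    by rewrite -exprMn mulrA.
  rewrite !sq; apply: lerD.
    rewrite ler_wpM2r ?exprn_ge0// -exprM mulnC.
    rewrite (_ : 2 = (q * 2)%:R * q%:R^-1); last by rewrite natrM mulrAC mulfV ?mul1r// gt_eqF.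
    by apply: expr_le_expR; lra.
  rewrite ler_wpM2r ?exprn_ge0// lerXn2r// ?nnegrE; nra.
rewrite bE in step1 step2 *.
apply: (le_trans step1); rewrite aE.
have h1 : 4 * q%:R ^+ 2 * (v * U ^+ m) <=
   4 * q%:R ^+ 2 * ((q%:R * n%:R)^-1 * (expR 2 * u ^+ q + (4 * q%:R ^+ 2) ^+ q * v ^+ q)
       + (q%:R * n%:R) ^+ m * v ^+ q).
  rewrite ler_wpM2l ?mulr_ge0 ?exprn_ge0//.
  apply: (le_trans step2); rewrite -exprVn invrK lerD2r ler_wpM2l// ltW//.
have h2 : (4 * q%:R ^+ 2) ^+ q * (q%:R * n%:R)^-1 <= (4 * q%:R) ^+ q * n%:R ^+ m :> R.
  rewrite ler_pdivrMr ?mulr_gt0//.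
  have -> : 4 * q%:R ^+ 2 = (4 * q%:R) * q%:R :> R by ring.
  rewrite exprMn -mulrA ler_wpM2l ?exprn_ge0 ?mulr_ge0//.
  rewrite (_ : n%:R ^+ m * (q%:R * n%:R) = n%:R ^+ q * q%:R); last by rewrite /q exprS; ring.
  apply: (@le_trans _ _ (n%:R ^+ q)).
    by rewrite lerXn2r// nnegrE ltW.
  by rewrite ler_peMr// exprn_ge0// ltW.
have h3 : (q%:R * n%:R) ^+ m <= (4 * q%:R) ^+ q * n%:R ^+ m :> R.
  have n0' := ltW n0; have q0' := ltW q0; rewrite exprMn ler_wpM2r ?exprn_ge0//.
  apply: (@le_trans _ _ ((4 * q%:R) ^+ m)).
    rewrite lerXn2r ?nnegrE//; nra.
  by rewrite ler_weXn2l//; nra.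
apply: (@le_trans _ _ (u ^+ q + (2 * q)%:R * a ^+ (2 * q).-1 * b +
   4 * q%:R ^+ 2 * ((q%:R * n%:R)^-1 * (expR 2 * u ^+ q)
     + 2 * ((4 * q%:R) ^+ q * n%:R ^+ m) * v ^+ q))).
  rewrite lerD2l; apply: (le_trans h1); rewrite ler_wpM2l ?mulr_ge0 ?exprn_ge0//.
  rewrite mulrDr -addrA lerD2l.
  have vq : 0 <= v ^+ q by rewrite exprn_ge0.
  have h2' := ler_wpM2r vq h2; have h3' := ler_wpM2r vq h3; lra.
rewrite le_eqVlt; apply/orP; left; apply/eqP => /=.
by field; rewrite !gt_eqF.
Qed.

(** Convexity of powers in tangent form; Jensen's inequality enters through it. *)
Lemma bernoulli_tangent n x a : 0 <= x -> 0 <= a ->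
  a ^+ n.+1 + n.+1%:R * a ^+ n * (x - a) <= x ^+ n.+1.
Proof.
move=> x0 a0; elim: n => [|n IH]; first by rewrite expr0 !expr1; lra.
have := ler_wpM2l x0 IH; rewrite -exprS; apply: le_trans.
rewrite -subr_ge0.
have -> : x * (a ^+ n.+1 + n.+1%:R * a ^+ n * (x - a)) -
  (a ^+ n.+2 + n.+2%:R * a ^+ n.+1 * (x - a)) = n.+1%:R * a ^+ n * (x - a) ^+ 2.
  by rewrite -(natr1 n.+1) (exprS a n.+1) (exprS a n); ring.
by rewrite mulr_ge0 ?sqr_ge0// mulr_ge0// exprn_ge0.
Qed.

(** Jensen's inequality: sum the tangent inequality taken at the mean. *)
Lemma power_mean (I : finType) (A : {set I}) (x : I -> R) n : (forall i, 0 <= x i) ->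
  (\sum_(i in A) x i) ^+ n.+1 <= #|A|%:R ^+ n * \sum_(i in A) x i ^+ n.+1.
Proof.
move=> x0; have [I0|I0] := posnP #|A|.
  by rewrite !big1 ?expr0n ?mulr0// => i; rewrite (card0_eq I0).
have N0 : (0 : R) < #|A|%:R by rewrite ltr0n.
set N : R := #|A|%:R in N0 *; set s : R := \sum_(i in A) x i; pose a := s / N.
have s0 : 0 <= s by apply: sumr_ge0.
have a0 : 0 <= a by rewrite divr_ge0// ltW.
have : \sum_(i in A) (a ^+ n.+1 + n.+1%:R * a ^+ n * (x i - a)) <= \sum_(i in A) x i ^+ n.+1.
  by apply: ler_sum => i _; exact: bernoulli_tangent.
rewrite big_split /= -mulr_sumr sumrB -/s !sumr_const -[a *+ _]mulr_natr.
rewrite -/N divfK ?gt_eqF// subrr mulr0 addr0 -mulr_natr -/N.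
have -> : a ^+ n.+1 * N = s ^+ n.+1 / N ^+ n.
  by rewrite /a expr_div_n (exprS N); field; rewrite !gt_eqF// exprn_gt0.
by rewrite ler_pdivrMr ?exprn_gt0// mulrC.
Qed.

Lemma power_meanT (I : finType) (x : I -> R) n : (forall i, 0 <= x i) ->
  (\sum_i x i) ^+ n.+1 <= #|I|%:R ^+ n * \sum_i x i ^+ n.+1.
Proof.
move=> x0; have := @power_mean I [set: I]%SET x n x0; rewrite cardsT.
have e (y : I -> R) : \sum_(i in [set: I]%SET) y i = \sum_i y i.
  by apply: eq_bigl => i; rewrite inE.
by rewrite !e.
Qed.

End PowerInequalities.

(** * Norms, the restricted cone and restricted eigenvalues *)

Section PanelLasso.
Variable R : realType.

Lemma mx_norm_entry (m : nat) (v : 'cV[R]_m) c i : mx_norm v <= c -> `|v i 0| <= c.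
Proof.
rewrite mx_normrE; apply: le_trans.
exact: (le_bigmax _ (fun ij : 'I_m * 'I_1 => `|v ij.1 ij.2|) (i, 0)).
Qed.

Lemma mx_norm_le (m : nat) (v : 'cV[R]_m) c : 0 <= c ->
  (forall i, `|v i 0| <= c) -> mx_norm v <= c.
Proof.
move=> c0 h; rewrite mx_normrE; apply: bigmax_le => // -[i j] _ /=.
by rewrite (ord1 j).
Qed.

Lemma l2norm_sqr (m : nat) (v : 'cV[R]_m) : l2norm v ^+ 2 = \sum_i v i 0 ^+ 2.
Proof. by rewrite sqr_sqrtr// sumr_ge0// => i _; exact: sqr_ge0. Qed.

Lemma l2norm_ge0 (m : nat) (v : 'cV[R]_m) : 0 <= l2norm v.
Proof. exact: sqrtr_ge0. Qed.

Lemma l2norm_col_mx (m n : nat) (u : 'cV[R]_m) (v : 'cV[R]_n) :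
  l2norm (col_mx u v) ^+ 2 = l2norm u ^+ 2 + l2norm v ^+ 2.
Proof.
rewrite !l2norm_sqr big_split_ord; congr (_ + _); apply: eq_bigr => i _.
  by rewrite col_mxEu.
by rewrite col_mxEd.
Qed.

Lemma l2norm_eq0 (m : nat) (v : 'cV[R]_m) : (l2norm v == 0) = (v == 0).
Proof.
apply/eqP/eqP => [h|->].
  apply/matrixP => i j; rewrite ord1 mxE; apply/eqP; rewrite -sqrf_eq0.
  have /eqP := l2norm_sqr v; rewrite h expr0n eq_sym psumr_eq0 => [/allP h1|k _].
    exact: (h1 i (mem_index_enum _)).
  exact: sqr_ge0.
by rewrite /l2norm big1 ?sqrtr0// => i _; rewrite mxE expr0n.
Qed.

Lemma l2normZ (m : nat) (v : 'cV[R]_m) a : 0 <= a -> l2norm (a *: v) = a * l2norm v.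
Proof.
move=> a0; apply/eqP; rewrite -(@eqrXn2 _ 2)// ?mulr_ge0 ?l2norm_ge0//.
rewrite exprMn !l2norm_sqr mulr_sumr; apply/eqP; apply: eq_bigr => i _.
by rewrite mxE exprMn.
Qed.

Lemma l1norm_split (m : nat) (A : {set 'I_m}) (v : 'cV[R]_m) :
  l1norm v = l1norm_on A v + l1norm_on (~: A)%SET v.
Proof.
rewrite /l1norm /l1norm_on (bigID (mem A)) /=; congr (_ + _).
by apply: eq_bigl => i; rewrite inE.
Qed.

Lemma l1norm_on_ge0 (m : nat) (A : {set 'I_m}) (v : 'cV[R]_m) : 0 <= l1norm_on A v.
Proof. exact: sumr_ge0. Qed.

Lemma l1norm_onZ (m : nat) (A : {set 'I_m}) (v : 'cV[R]_m) a : 0 <= a ->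
  l1norm_on A (a *: v) = a * l1norm_on A v.
Proof.
move=> a0; rewrite /l1norm_on mulr_sumr; apply: eq_bigr => i _.
by rewrite mxE normrM ger0_norm.
Qed.

Lemma l1norm_on_sqr (m r : nat) (A : {set 'I_m}) (v : 'cV[R]_m) : (#|A| <= r)%N ->
  l1norm_on A v ^+ 2 <= r%:R * l2norm v ^+ 2.
Proof.
move=> Ar; have := @power_mean R _ A (fun i => `|v i 0|) 1 (fun i => normr_ge0 _).
rewrite expr1 => /le_trans; apply; apply: ler_pM => //.
- by apply: sumr_ge0 => i _; rewrite exprn_ge0.
- by rewrite ler_nat.
rewrite l2norm_sqr [leRHS](bigID (mem A)) /= -[leLHS]addr0; apply: lerD.
  by apply: ler_sum => i _; rewrite real_normK// num_real.
by apply: sumr_ge0 => i _; exact: sqr_ge0.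
Qed.

Lemma l1norm_on_le (m r : nat) (A : {set 'I_m}) (v : 'cV[R]_m) : (#|A| <= r)%N ->
  l1norm_on A v <= Num.sqrt r%:R * l2norm v.
Proof.
move=> /(l1norm_on_sqr v) h; rewrite -(@ler_pXn2r _ 2)// ?nnegrE ?l1norm_on_ge0//.
  by rewrite exprMn sqr_sqrtr.
by rewrite mulr_ge0 ?sqrtr_ge0// l2norm_ge0.
Qed.

Section Cone.
Variables (N T p : nat) (lam mu rho : R).
Let L := lam / Num.sqrt (N%:R * T%:R).
Let M := mu / Num.sqrt T%:R.
Hypothesis L0 : 0 < L.
Hypothesis M0 : 0 < M.
Hypothesis LM : L ^+ 2 <= rho * M ^+ 2.
Hypothesis ML : M ^+ 2 <= rho * L ^+ 2.

(** On the cone the weighted l1-norm is at most four times its part on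
    [R1] and [R2], and Cauchy-Schwarz bounds that part by the l2-norm.  Passing
    from the weighted to the plain l1-norm costs the squared ratio [rho] of the
    two weights. *)
Lemma cone_l1norm (d1 : 'cV[R]_p) (d2 : 'cV[R]_N) (R1 : {set 'I_p}) (R2 : {set 'I_N})
    (r1 r2 : nat) :
  re_cone T lam mu d1 d2 R1 R2 -> (#|R1| <= r1)%N -> (#|R2| <= r2)%N ->
  (l1norm d1 + l1norm d2) ^+ 2 <= 16 * rho * (r1 + r2)%:R * l2norm (col_mx d1 d2) ^+ 2.
Proof.
rewrite /re_cone -/L -/M => cone c1 c2.
set a1 := l1norm_on R1 d1 in cone *; set a2 := l1norm_on R2 d2 in cone *.
have a10 : 0 <= a1 by exact: l1norm_on_ge0.
have a20 : 0 <= a2 by exact: l1norm_on_ge0.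
have L0' := ltW L0; have M0' := ltW M0.
(* Adding the parts on R1 and R2 to both sides of the cone condition. *)
have tot : L * l1norm d1 + M * l1norm d2 <= 4 * (L * a1 + M * a2).
  by rewrite (l1norm_split R1 d1) (l1norm_split R2 d2) -/a1 -/a2; lra.
have D10 : 0 <= l1norm d1 by exact: sumr_ge0.
have D20 : 0 <= l1norm d2 by exact: sumr_ge0.
set D1 := l1norm d1 in tot D10 *; set D2 := l1norm d2 in tot D20 *.
have key (l m : R) : 0 < l -> l <= m -> m ^+ 2 <= rho * l ^+ 2 ->
    l * (D1 + D2) <= 4 * (m * (a1 + a2)) -> (D1 + D2) ^+ 2 <= 16 * rho * (a1 + a2) ^+ 2.
  move=> l0 lm ml h.
  have l2 : 0 < l ^+ 2 by rewrite exprn_gt0.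
  rewrite -(ler_pM2l l2) -exprMn.
  apply: (@le_trans _ _ ((4 * (m * (a1 + a2))) ^+ 2)).
    by rewrite lerXn2r ?nnegrE// !mulr_ge0 ?addr_ge0// ltW// (lt_le_trans l0).
  have := ler_wpM2r (sqr_ge0 (a1 + a2)) ml.
  have -> : (4 * (m * (a1 + a2))) ^+ 2 = 16 * (m ^+ 2 * (a1 + a2) ^+ 2) by ring.
  have -> : l ^+ 2 * (16 * rho * (a1 + a2) ^+ 2) = 16 * (rho * l ^+ 2 * (a1 + a2) ^+ 2) by ring.
  lra.
have h1 : (D1 + D2) ^+ 2 <= 16 * rho * (a1 + a2) ^+ 2.
  have [lm|ml] := leP L M.
    apply: (key L M) => //.
    apply: (@le_trans _ _ (L * D1 + M * D2)); first by rewrite mulrDr lerD2l ler_wpM2r.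
    apply: (le_trans tot); rewrite ler_wpM2l// mulrDr lerD2r ler_wpM2r//.
  have ml' := ltW ml; apply: (key M L) => //.
  apply: (@le_trans _ _ (L * D1 + M * D2)); first by rewrite mulrDr lerD2r ler_wpM2r.
  apply: (le_trans tot); rewrite ler_wpM2l// mulrDr lerD2l ler_wpM2r//.
have rho0 : 0 <= rho.
  have h := le_trans (sqr_ge0 L) LM.
  by rewrite -(@pmulr_lge0 _ (M ^+ 2))// exprn_gt0.
apply: (le_trans h1); rewrite -[leRHS]mulrA ler_wpM2l ?mulr_ge0// l2norm_col_mx natrD.
have s1 := l1norm_on_sqr d1 c1; have s2 := l1norm_on_sqr d2 c2.
rewrite -/a1 in s1; rewrite -/a2 in s2.
set n1 := l2norm d1 ^+ 2 in s1 *; set n2 := l2norm d2 ^+ 2 in s2 *.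
have n10 : 0 <= n1 by exact: sqr_ge0.
have n20 : 0 <= n2 by exact: sqr_ge0.
(* Geometric-arithmetic mean for the cross term. *)
have cross : 2 * (a1 * a2) <= r1%:R * n2 + r2%:R * n1.
  have e0 : 0 <= r1%:R * n2 + r2%:R * n1 by rewrite addr_ge0// mulr_ge0.
  rewrite -(@ler_pXn2r _ 2)// ?nnegrE ?mulr_ge0//.
  have h := ler_pM (sqr_ge0 a1) (sqr_ge0 a2) s1 s2.
  have := sqr_ge0 (r1%:R * n2 - r2%:R * n1).
  have -> : (2 * (a1 * a2)) ^+ 2 = 4 * (a1 ^+ 2 * a2 ^+ 2) by ring.
  move: h; move: (a1 ^+ 2 * a2 ^+ 2) => z; nra.
have -> : (a1 + a2) ^+ 2 = a1 ^+ 2 + 2 * (a1 * a2) + a2 ^+ 2 by ring.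
have -> : (r1%:R + r2%:R) * (n1 + n2) = r1%:R * n1 + (r1%:R * n2 + r2%:R * n1) + r2%:R * n2 by ring.
by rewrite !lerD.
Qed.

Lemma quad_formE (n : nat) (Q : 'M[R]_n) (v : 'cV[R]_n) :
  (v^T *m Q *m v) 0 0 = \sum_i \sum_j Q i j * (v i 0 * v j 0).
Proof.
rewrite mxE exchange_big /=; apply: eq_bigr => j _; rewrite mxE mulr_suml.
by apply: eq_bigr => i _; rewrite mxE; ring.
Qed.

Lemma quad_form_perturb (n : nat) (Q Q' : 'M[R]_n) (v : 'cV[R]_n) tau :
  (forall i j, `|Q i j - Q' i j| <= tau) ->
  `|(v^T *m Q *m v) 0 0 - (v^T *m Q' *m v) 0 0| <= tau * l1norm v ^+ 2.
Proof.
move=> h; rewrite !quad_formE -sumrB.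
apply: (@le_trans _ _ (\sum_i \sum_j tau * (`|v i 0| * `|v j 0|))).
  apply: (le_trans (ler_norm_sum _ _ _)); apply: ler_sum => i _.
  rewrite -sumrB; apply: (le_trans (ler_norm_sum _ _ _)); apply: ler_sum => j _.
  by rewrite -mulrBl !normrM ler_wpM2r// mulr_ge0.
rewrite le_eqVlt; apply/orP; left; apply/eqP.
rewrite expr2 /l1norm mulr_suml mulr_sumr; apply: eq_bigr => i _.
by rewrite !mulr_sumr; apply: eq_bigr.
Qed.

(** A positive infimum cannot be the default value 0 that [inf] takes outside its
    domain, so it is a genuine lower bound of the Rayleigh quotients. *)
Lemma kappa2_le (Q : 'M[R]_(p + N)) (r1 r2 : nat) d1 d2 (R1 : {set 'I_p}) (R2 : {set 'I_N}) :
  let d := col_mx d1 d2 in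
  0 < kappa2 T lam mu Q r1 r2 -> (#|R1| <= r1)%N -> (#|R2| <= r2)%N ->
  re_cone T lam mu d1 d2 R1 R2 ->
  kappa2 T lam mu Q r1 r2 * l2norm d ^+ 2 <= (d^T *m Q *m d) 0 0.
Proof.
move=> d k0 c1 c2 cone; have [d0|dn0] := eqVneq d 0.
  by rewrite d0 trmx0 mul0mx mul0mx mxE (eqP (_ : l2norm 0 == 0)) ?expr0n ?mulr0// l2norm_eq0.
have n0 : 0 < l2norm d ^+ 2.
  by rewrite exprn_gt0// lt_def l2norm_ge0 l2norm_eq0 dn0.
rewrite -ler_pdivlMr//; apply: ge_inf; last by exists d1, d2, R1, R2.
by apply: contrapT => h; move: k0; rewrite /kappa2 inf_out ?ltxx// => -[].
Qed.

Lemma kappa2_nonempty (Q : 'M[R]_(p + N)) (r1 r2 : nat) :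
  0 < kappa2 T lam mu Q r1 r2 ->
  exists d1 d2 (R1 : {set 'I_p}) (R2 : {set 'I_N}),
   [/\ col_mx d1 d2 != 0, (#|R1| <= r1)%N, (#|R2| <= r2)%N & re_cone T lam mu d1 d2 R1 R2].
Proof.
move=> k0; have [[q [d1 [d2 [R1 [R2 [h1 h2 h3 h4 _]]]]]] _] : has_inf [set q : R | exists (d1 : 'cV[R]_p) (d2 : 'cV[R]_N)
        (R1 : {set 'I_p}) (R2 : {set 'I_N}),
      let d := col_mx d1 d2 in
      [/\ d != 0, (#|R1| <= r1)%N, (#|R2| <= r2)%N,
          re_cone T lam mu d1 d2 R1 R2 &
          q = (d^T *m Q *m d) 0 0 / l2norm d ^+ 2]].
  by apply: contrapT => h; move: k0; rewrite /kappa2 inf_out ?ltxx.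
by exists d1, d2, R1, R2.
Qed.

(** The hypothesis on [tau] makes the change of the quadratic form on the cone at
    most half of the restricted eigenvalue times the squared l2-norm. *)
Lemma kappa2_perturb (Q Q' : 'M[R]_(p + N)) (r1 r2 : nat) tau :
  0 < kappa2 T lam mu Q r1 r2 ->
  (forall i j, `|Q' i j - Q i j| <= tau) ->
  tau * (16 * rho * (r1 + r2)%:R) <= kappa2 T lam mu Q r1 r2 / 2 ->
  kappa2 T lam mu Q r1 r2 / 2 <= kappa2 T lam mu Q' r1 r2.
Proof.
set k := kappa2 _ _ _ _ _ _ => k0 htau hk.
have [d1 [d2 [R1 [R2 [h1 h2 h3 h4]]]]] := kappa2_nonempty k0.
apply: lb_le_inf; first by eexists; exists d1, d2, R1, R2; split.
move=> {d1 d2 R1 R2 h1 h2 h3 h4} q [d1 [d2 [R1 [R2 [dn0 c1 c2 cone ->]]]]].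
set d := col_mx d1 d2 in dn0 *.
have n0 : 0 < l2norm d ^+ 2.
  by rewrite exprn_gt0// lt_def l2norm_ge0 l2norm_eq0 dn0.
rewrite ler_pdivlMr//.
have a1 := kappa2_le k0 c1 c2 cone; rewrite -/d -/k in a1.
have := quad_form_perturb d htau; rewrite ler_norml => /andP[a2 _].
have a3 : l1norm d = l1norm d1 + l1norm d2.
  rewrite /l1norm big_split_ord; congr (_ + _); apply: eq_bigr => i _.
    by rewrite col_mxEu.
  by rewrite col_mxEd.
have a4 := cone_l1norm cone c1 c2; rewrite -a3 -/d in a4.
have tau0 : 0 <= tau.
  have [z] : exists z : 'I_(p + N), d z 0 != 0.
    apply: contrapT => /forallNP h; move/eqP: dn0; apply.
    by apply/matrixP => i j; rewrite ord1 [RHS]mxE; apply/eqP/negP/negP; move: (h i) => /negP; rewrite negbK.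
  by move=> _; exact: le_trans (normr_ge0 _) (htau z z).
have a5 := ler_wpM2l tau0 a4.
have a6 := ler_wpM2r (ltW n0) hk.
have -> : k / 2 * l2norm d ^+ 2 = k * l2norm d ^+ 2 - k / 2 * l2norm d ^+ 2 by field.
move: a5; rewrite (_ : tau * (16 * rho * (r1 + r2)%:R * l2norm d ^+ 2) =
  tau * (16 * rho * (r1 + r2)%:R) * l2norm d ^+ 2); last by ring.
lra.
Qed.

End Cone.

(** * The Lasso on the good events *)

Lemma stackE (N T : nat) (u : 'I_N -> 'I_T -> R) i t :
  stack u (mxvec_index i t) 0 = u i t.
Proof. by rewrite /stack mxE mxvecE mxE. Qed.

Lemma sum_stack (N T : nat) (F : 'I_(N * T) -> R) :
  \sum_r F r = \sum_i \sum_t F (mxvec_index i t).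
Proof.
rewrite pair_big /= (reindex _ (curry_mxvec_bij N T)) /=.
by apply: eq_bigr => -[i t].
Qed.

Lemma stack_model (N T p : nat) (x : 'I_N -> 'I_T -> 'I_p -> R)
    (y e : 'I_N -> 'I_T -> R) (b : 'cV[R]_p) (c : 'cV[R]_N) :
  (forall i t, y i t = \sum_k x i t k * b k 0 + c i 0 + e i t) ->
  stack y = design_mx x *m col_mx b c + stack e.
Proof.
move=> h; apply/matrixP => r j; rewrite (ord1 j) {j}.
case/mxvec_indexP: r => i t; rewrite stackE h mxE stackE; congr (_ + _).
rewrite mul_row_col !mxE; congr (_ + _).
  by apply: eq_bigr => k _; rewrite mxE stackE.
rewrite (bigD1 i) //= big1 => [|j ji]; last by rewrite mxE stackE eq_sym (negbTE ji) mul0r.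
by rewrite mxE stackE eqxx mul1r addr0.
Qed.

Lemma l2norm_sqrB (m : nat) (u v : 'cV[R]_m) :
  l2norm (u - v) ^+ 2 = l2norm u ^+ 2 - 2 * (\sum_i u i 0 * v i 0) + l2norm v ^+ 2.
Proof.
rewrite !l2norm_sqr mulr_sumr -sumrB -big_split; apply: eq_bigr => i _ /=.
by rewrite !mxE; ring.
Qed.

(** Hoelder's inequality after moving [A] to the other side. *)
Lemma dot_mulmx_le (m n : nat) (A : 'M[R]_(m, n)) (u : 'cV[R]_m) (v : 'cV[R]_n) c :
  mx_norm (A^T *m u) <= c -> `|\sum_i u i 0 * (A *m v) i 0| <= c * l1norm v.
Proof.
move=> h; rewrite (_ : \sum_i _ = \sum_j (A^T *m u) j 0 * v j 0).
  apply: (le_trans (ler_norm_sum _ _ _)); rewrite /l1norm mulr_sumr; apply: ler_sum => j _.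
  by rewrite normrM ler_wpM2r// mx_norm_entry.
under eq_bigr do rewrite mxE mulr_sumr.
rewrite exchange_big /=; apply: eq_bigr => j _; rewrite mxE mulr_suml.
by apply: eq_bigr => i _; rewrite mxE; ring.
Qed.

(** How the l1-penalty enters the basic inequality: on the support the two norms
    differ by at most the error, off the support the estimate is the error. *)
Lemma l1norm_support_diff (m : nat) (b h : 'cV[R]_m) (A : {set 'I_m}) :
  (forall i, i \notin A -> b i 0 = 0) ->
  l1norm b - l1norm h <= l1norm_on A (h - b) - l1norm_on (~: A)%SET (h - b).
Proof.
move=> bA; rewrite (l1norm_split A b) (l1norm_split A h).
have -> : l1norm_on (~: A)%SET b = 0.
  by rewrite /l1norm_on big1// => i; rewrite inE => /bA ->; rewrite normr0.
have -> : l1norm_on (~: A)%SET (h - b) = l1norm_on (~: A)%SET h.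
  by apply: eq_bigr => i; rewrite inE => /bA e; rewrite !mxE e subr0.
have : l1norm_on A b - l1norm_on A h <= l1norm_on A (h - b).
  rewrite /l1norm_on -sumrB; apply: ler_sum => i _; rewrite !mxE.
  by rewrite distrC; exact: lerB_dist.
lra.
Qed.

Lemma scaling_col_mx (N T p : nat) (u : 'cV[R]_p) (v : 'cV[R]_N) :
  scaling_mx R N T p *m col_mx u v =
  col_mx (Num.sqrt (N%:R * T%:R) *: u) (Num.sqrt T%:R *: v).
Proof.
by rewrite /scaling_mx mul_block_col !mul0mx addr0 add0r !mul_scalar_mx.
Qed.

Lemma scaling_unit (N T p : nat) : (0 < N)%N -> (0 < T)%N ->
  scaling_mx R N T p \in unitmx.
Proof.
move=> N0 T0; rewrite unitmxE /scaling_mx det_ublock !det_scalar unitfE mulf_neq0//.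
  by rewrite expf_neq0// gt_eqF// sqrtr_gt0 mulr_gt0 ?ltr0n.
by rewrite expf_neq0// gt_eqF// sqrtr_gt0 ltr0n.
Qed.

Lemma scaling_tr (N T p : nat) : (scaling_mx R N T p)^T = scaling_mx R N T p.
Proof. by rewrite /scaling_mx tr_block_mx !trmx0 !tr_scalar_mx. Qed.

Lemma Psi_quad_form (N T p : nat) (x : 'I_N -> 'I_T -> 'I_p -> R) (d : 'cV[R]_(p + N)) :
  (0 < N)%N -> (0 < T)%N ->
  let u := scaling_mx R N T p *m d in
  (u^T *m Psi_mx x *m u) 0 0 = l2norm (design_mx x *m d) ^+ 2.
Proof.
move=> N0 T0 u; have Su := @scaling_unit N T p N0 T0.
have -> : u^T *m Psi_mx x *m u = (design_mx x *m d)^T *m (design_mx x *m d).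
  rewrite /u /Psi_mx !trmx_mul scaling_tr !mulmxA.
  rewrite -(mulmxA d^T) mulmxV// mulmx1.
  by rewrite -[in LHS](mulmxA _ (invmx _) (scaling_mx _ _ _ _)) mulVmx// mulmx1.
by rewrite mxE l2norm_sqr; apply: eq_bigr => i _; rewrite mxE expr2.
Qed.

(** The basic inequality gives both the cone condition for the rescaled error [u]
    and |Z d|^2 <= 3 (lam |d1|_1 + mu |d2|_1) with the l1-norms taken on the
    supports.  The left side equals the quadratic form of [Psi_mx] at [u], hence is at
    least [kap / 2] times |u|^2, while the right side is linear in |u|. *)
Lemma lasso_bound (N T p : nat) (lam mu kap : R)
    (x : 'I_N -> 'I_T -> 'I_p -> R) (y e : 'I_N -> 'I_T -> R)
    (b bhat : 'cV[R]_p) (c chat : 'cV[R]_N) :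
  (0 < N)%N -> (0 < T)%N -> 0 < lam -> 0 < mu -> 0 < kap ->
  (forall i t, y i t = \sum_k x i t k * b k 0 + c i 0 + e i t) ->
  mx_norm ((covariate_mx x)^T *m stack e) <= lam / 2 ->
  mx_norm ((dummy_mx R N T)^T *m stack e) <= mu / 2 ->
  kap / 2 <= kappa2 T lam mu (Psi_mx x) (sparsity b) (sparsity c) ->
  is_panel_lasso lam mu x y bhat chat ->
  let B := 6 * (lam / Num.sqrt (N%:R * T%:R) * Num.sqrt (sparsity b)%:R +
                mu / Num.sqrt T%:R * Num.sqrt (sparsity c)%:R) / kap in
  l2norm (bhat - b) <= B / Num.sqrt (N%:R * T%:R) /\ l2norm (chat - c) <= B / Num.sqrt T%:R.
Proof.
move=> N0 T0 lam0 mu0 kap0 ymod hX hD hk lasso B.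
set sNT : R := Num.sqrt (N%:R * T%:R) in B *; set sT : R := Num.sqrt T%:R in B *.
have sNT0 : 0 < sNT by rewrite sqrtr_gt0 mulr_gt0 ?ltr0n.
have sT0 : 0 < sT by rewrite sqrtr_gt0 ltr0n.
pose d1 := bhat - b; pose d2 := chat - c; pose d := col_mx d1 d2.
pose R1 := [set i | b i 0 != 0]%SET; pose R2 := [set i | c i 0 != 0]%SET.
have cR1 : #|R1| = sparsity b by rewrite cardsE.
have cR2 : #|R2| = sparsity c by rewrite cardsE.
have bR1 i : i \notin R1 -> b i 0 = 0 by rewrite inE negbK => /eqP.
have cR2' i : i \notin R2 -> c i 0 = 0 by rewrite inE negbK => /eqP.
have zE : design_mx x *m d = covariate_mx x *m d1 + dummy_mx R N T *m d2.
  by rewrite mul_row_col.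
have main : l2norm (design_mx x *m d) ^+ 2 + lam * l1norm_on (~: R1)%SET d1
     + mu * l1norm_on (~: R2)%SET d2 <= 3 * lam * l1norm_on R1 d1 + 3 * mu * l1norm_on R2 d2.
  have := lasso b c; rewrite /lasso_objective (stack_model ymod).
  have -> : design_mx x *m col_mx b c + stack e - design_mx x *m col_mx bhat chat =
      stack e - design_mx x *m d.
    rewrite /d (_ : col_mx d1 d2 = col_mx bhat chat - col_mx b c); last first.
      by rewrite opp_col_mx add_col_mx.
    by rewrite mulmxBr opprB addrCA addrA.
  rewrite [design_mx x *m col_mx b c + _]addrC addrK l2norm_sqrB.
  have -> : \sum_i stack e i 0 * (design_mx x *m d) i 0 =
     \sum_i stack e i 0 * (covariate_mx x *m d1) i 0 +
     \sum_i stack e i 0 * (dummy_mx R N T *m d2) i 0.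
    by rewrite -big_split /=; apply: eq_bigr => i _; rewrite zE -mulrDr; congr (_ * _); rewrite [LHS]mxE.
  have := dot_mulmx_le d1 hX; have := dot_mulmx_le d2 hD.
  have := l1norm_support_diff bhat bR1; have := l1norm_support_diff chat cR2'.
  rewrite -/d1 -/d2 (l1norm_split R1 d1) (l1norm_split R2 d2).
  move=> /(ler_wpM2l (ltW mu0)) i1 /(ler_wpM2l (ltW lam0)) i2.
  move=> /(le_trans (ler_norm _)) i3 /(le_trans (ler_norm _)) i4.
  move: i1 i2 i3 i4; lra.
pose u := col_mx (sNT *: d1) (sT *: d2).
have uE : scaling_mx R N T p *m d = u by rewrite scaling_col_mx.
have cone : re_cone T lam mu (sNT *: d1) (sT *: d2) R1 R2.
  rewrite /re_cone -/sNT -/sT !l1norm_onZ ?(ltW sNT0) ?(ltW sT0)//.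
  rewrite !mulrA !divfK ?gt_eqF//.
  have := sqr_ge0 (l2norm (design_mx x *m d)); move: main.
  lra.
have k0 : 0 < kappa2 T lam mu (Psi_mx x) (sparsity b) (sparsity c).
  by apply: lt_le_trans hk; rewrite divr_gt0.
have q1 := kappa2_le k0 (eq_leq cR1) (eq_leq cR2) cone.
rewrite -/u -uE Psi_quad_form// uE in q1.
set nu := l2norm u in q1.
have nu0 : 0 <= nu by exact: l2norm_ge0.
have n1 : sNT * l2norm d1 <= nu.
  rewrite -l2normZ ?(ltW sNT0)// -(@ler_pXn2r _ 2)// ?nnegrE ?l2norm_ge0//.
  by rewrite l2norm_col_mx lerDl sqr_ge0.
have n2 : sT * l2norm d2 <= nu.
  rewrite -l2normZ ?(ltW sT0)// -(@ler_pXn2r _ 2)// ?nnegrE ?l2norm_ge0//.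
  by rewrite l2norm_col_mx lerDr sqr_ge0.
have a1 := l1norm_on_le d1 (eq_leq cR1).
have a2 := l1norm_on_le d2 (eq_leq cR2).
have nuB : nu <= B.
  have [->|nun0] := eqVneq nu 0.
    have [lam0' mu0' kap0'] := And3 (ltW lam0) (ltW mu0) (ltW kap0).
    have [sNT0' sT0'] := conj (ltW sNT0) (ltW sT0).
    by apply: divr_ge0 => //; rewrite mulr_ge0// addr_ge0// mulr_ge0 ?sqrtr_ge0// divr_ge0.
  have nup : 0 < nu by rewrite lt_def nun0.
  rewrite /B ler_pdivlMr// -(ler_pM2r nup).
  have b1 : lam * l1norm_on R1 d1 <= lam / sNT * Num.sqrt (sparsity b)%:R * nu.
    rewrite -!mulrA ler_wpM2l ?(ltW lam0)//; apply: (le_trans a1).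
    by rewrite ler_pdivlMl// mulrCA ler_wpM2l ?sqrtr_ge0.
  have b2 : mu * l1norm_on R2 d2 <= mu / sT * Num.sqrt (sparsity c)%:R * nu.
    rewrite -!mulrA ler_wpM2l ?(ltW mu0)//; apply: (le_trans a2).
    by rewrite ler_pdivlMl// mulrCA ler_wpM2l ?sqrtr_ge0.
  have b3 := ler_wpM2r (sqr_ge0 nu) hk.
  have b4 := mulr_ge0 (ltW lam0) (l1norm_on_ge0 (~: R1)%SET d1).
  have b5 := mulr_ge0 (ltW mu0) (l1norm_on_ge0 (~: R2)%SET d2).
  move: main q1 b1 b2 b3 b4 b5; lra.
by split; rewrite ler_pdivlMr// mulrC (le_trans _ nuB).
Qed.

(** * Entries of the scaled Gram matrix *)

Lemma invmx_scaling (N T p : nat) : (0 < N)%N -> (0 < T)%N ->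
  invmx (scaling_mx R N T p) =
  block_mx (Num.sqrt (N%:R * T%:R))^-1%:M 0 0 (Num.sqrt T%:R)^-1%:M.
Proof.
move=> N0 T0; have Su := @scaling_unit N T p N0 T0.
set S' := RHS; have e : S' *m scaling_mx R N T p = 1%:M.
  rewrite /S' /scaling_mx mulmx_block !mulmx0 !mul0mx !addr0 !add0r -!scalar_mxM.
  rewrite !mulVf ?scalar_mx_block//.
    by rewrite gt_eqF// sqrtr_gt0 ltr0n.
  by rewrite gt_eqF// sqrtr_gt0 mulr_gt0 ?ltr0n.
by rewrite -[S']mulmx1 -(mulmxV Su) mulmxA e mul1mx.
Qed.

Lemma covariate_mxE (N T p : nat) (x : 'I_N -> 'I_T -> 'I_p -> R) i t k :
  covariate_mx x (mxvec_index i t) k = x i t k.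
Proof. by rewrite mxE stackE. Qed.

Lemma dummy_mxE (N T : nat) (i j : 'I_N) (t : 'I_T) :
  dummy_mx R N T (mxvec_index i t) j = (i == j)%:R.
Proof. by rewrite mxE stackE. Qed.

Lemma gram_covariateE (N T p : nat) (x : 'I_N -> 'I_T -> 'I_p -> R) j k :
  ((covariate_mx x)^T *m covariate_mx x) j k = \sum_i \sum_t x i t j * x i t k.
Proof.
rewrite mxE sum_stack; apply: eq_bigr => i _; apply: eq_bigr => t _.
by rewrite mxE !covariate_mxE.
Qed.

Lemma covariate_dummyE (N T p : nat) (x : 'I_N -> 'I_T -> 'I_p -> R) k i :
  ((covariate_mx x)^T *m dummy_mx R N T) k i = \sum_t x i t k.
Proof.
rewrite mxE sum_stack (bigD1 i)//= [X in _ + X]big1 ?addr0 => [|j ji].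
  by apply: eq_bigr => t _; rewrite mxE covariate_mxE dummy_mxE eqxx mulr1.
by apply: big1 => t _; rewrite dummy_mxE (negbTE ji) mulr0.
Qed.

Lemma gram_dummyE (N T : nat) : (dummy_mx R N T)^T *m dummy_mx R N T = T%:R%:M.
Proof.
apply/matrixP => i j; rewrite mxE sum_stack (bigD1 i)//= [X in _ + X]big1 ?addr0; last first.
  by move=> k ki; apply: big1 => t _; rewrite mxE dummy_mxE (negbTE ki) mul0r.
rewrite (eq_bigr (fun=> (i == j)%:R)) => [|t _]; last first.
  by rewrite mxE !dummy_mxE eqxx mul1r.
by rewrite sumr_const card_ord mxE; case: (i == j); rewrite ?mulr1n ?mulr0n ?mul0rn.
Qed.

Lemma covariate_errorE (N T p : nat) (x : 'I_N -> 'I_T -> 'I_p -> R) (e : 'I_N -> 'I_T -> R) k :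
  ((covariate_mx x)^T *m stack e) k 0 = \sum_i \sum_t x i t k * e i t.
Proof.
rewrite mxE sum_stack; apply: eq_bigr => i _; apply: eq_bigr => t _.
by rewrite mxE covariate_mxE stackE.
Qed.

Lemma dummy_errorE (N T : nat) (e : 'I_N -> 'I_T -> R) i :
  ((dummy_mx R N T)^T *m stack e) i 0 = \sum_t e i t.
Proof.
rewrite mxE sum_stack (bigD1 i)//= [X in _ + X]big1 ?addr0 => [|j ji].
  by apply: eq_bigr => t _; rewrite mxE dummy_mxE stackE eqxx mul1r.
by apply: big1 => t _; rewrite mxE dummy_mxE (negbTE ji) mul0r.
Qed.

Lemma Psi_mxE (N T p : nat) (x : 'I_N -> 'I_T -> 'I_p -> R) : (0 < N)%N -> (0 < T)%N ->
  Psi_mx x =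
  block_mx (\matrix_(j, k) ((\sum_i \sum_t x i t j * x i t k) / (N%:R * T%:R)))
           (\matrix_(k, i) ((\sum_t x i t k) / (Num.sqrt N%:R * T%:R)))
           (\matrix_(i, k) ((\sum_t x i t k) / (Num.sqrt N%:R * T%:R)))
           1%:M.
Proof.
move=> N0 T0; rewrite /Psi_mx invmx_scaling// /design_mx tr_row_mx.
have sT : Num.sqrt T%:R * Num.sqrt T%:R = T%:R :> R by rewrite -expr2 sqr_sqrtr.
have sNT : Num.sqrt (N%:R * T%:R) = Num.sqrt N%:R * Num.sqrt T%:R :> R by rewrite sqrtrM.
have sN : Num.sqrt N%:R * Num.sqrt N%:R = N%:R :> R by rewrite -expr2 sqr_sqrtr.
rewrite -[X in X *m _]mulmxA mul_col_row mulmx_block !mul0mx !addr0 !add0r.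
rewrite mulmx_block !mulmx0 !addr0 !add0r !mul_scalar_mx !mul_mx_scalar !scalerA -!invfM.
rewrite gram_dummyE sT scale_scalar_mx mulVf ?pnatr_eq0 -?lt0n//.
congr block_mx; apply/matrixP => j k; rewrite [LHS]mxE [RHS]mxE.
- by rewrite gram_covariateE mulrC; congr (_ / _); rewrite sNT -[in RHS]sN -[in RHS]sT; ring.
- by rewrite covariate_dummyE mulrC; congr (_ / _); rewrite sNT -[in RHS]sT; ring.
- have -> : ((dummy_mx R N T)^T *m covariate_mx x) j k =
      ((covariate_mx x)^T *m dummy_mx R N T) k j.
    by rewrite -[in RHS](trmxK (dummy_mx R N T)) -trmx_mul [RHS]mxE.
  by rewrite covariate_dummyE mulrC; congr (_ / _); rewrite sNT -[in RHS]sT; ring.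
Qed.

(** * Measurability of the restricted eigenvalue event *)

(** The open set is the union of the countably many balls with rational centre
    and radius 1/(k+1) that it contains; the preimage of each ball is cut out by
    finitely many conditions on the entries. *)
Lemma measurable_open_matrix (d : measure_display) (Omega : measurableType d) (n : nat)
    (M : Omega -> 'M[R]_n) (U : set 'M[R]_n) :
  (forall i j, measurable_fun setT (fun w => M w i j)) ->
  (forall Q, U Q -> exists2 e : R, 0 < e &
     forall Q' : 'M[R]_n, (forall i j, `|Q' i j - Q i j| <= e) -> U Q') ->
  measurable (M @^-1` U).
Proof.
move=> mM oU.
pose ball (z : 'M[rat]_n * nat) : set 'M[R]_n :=
  [set Q | forall i j, `|Q i j - ratr (z.1 i j)| < z.2.+1%:R^-1].
pose F k := if unpickle k is Some z then
  (if `[< ball z `<=` U >] then M @^-1` ball z else set0) else set0.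
have -> : M @^-1` U = \bigcup_k F k.
  apply/seteqP; split => [w Uw|w [k _]]; last first.
    rewrite /F; case: unpickle => [z|]//; case: asboolP => // h; exact: h.
  have [e e0 he] := oU _ Uw.
  (* Two points of a ball of radius 1/(k+1) are then less than e apart. *)
  pose k := Num.truncn (2 / e).
  have ke : k.+1%:R^-1 < e / 2.
    have : 2 / e < k.+1%:R by apply: truncnS_gt.
    rewrite -[X in _ -> _ < X]invf_div => h.
    by rewrite ltf_pV2// ?posrE// divr_gt0.
  have k0 : 0 < k.+1%:R^-1 :> R by rewrite invr_gt0.
  have /choice[q hq] : forall ij : 'I_n * 'I_n, exists q : rat,
      `|M w ij.1 ij.2 - ratr q| < k.+1%:R^-1.
    move=> ij; set r := M w ij.1 ij.2.
    have rk : r - k.+1%:R^-1 < r + k.+1%:R^-1.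
      by rewrite ltrD2l (lt_trans _ k0)// oppr_lt0.
    have [q] := rat_in_itvoo rk.
    by rewrite in_itv /= => /andP[q1 q2]; exists q; rewrite distrC ltr_distl q1.
  pose z := (\matrix_(i, j) q (i, j), k).
  exists (pickle z) => //; rewrite /F pickleK.
  have zw : ball z (M w) by move=> i j; rewrite /z /= mxE; exact: (hq (i, j)).
  case: asboolP => // -[] Q' hQ'; apply: he => i j.
  have h1 := zw i j; have h2 := hQ' i j.
  have -> : Q' i j - M w i j = (Q' i j - ratr (z.1 i j)) - (M w i j - ratr (z.1 i j)) by ring.
  apply: (le_trans (ler_normB _ _)); rewrite [leRHS]splitr.
  by rewrite lerD// ltW// (lt_trans _ ke).
apply: bigcupT_measurable => k; rewrite /F; case: unpickle => [z|]//; case: asboolP => // _.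
rewrite (_ : M @^-1` ball z = \bigcap_(ij in [set: 'I_n * 'I_n])
    [set w | `|M w ij.1 ij.2 - ratr (z.1 ij.1 ij.2)| < z.2.+1%:R^-1]); last first.
  apply/seteqP; split => w h; first by move=> [i j] _; exact: h.
  by move=> i j; exact: (h (i, j)).
apply: fin_bigcap_measurable; first exact: finite_finset.
move=> [i j] _ /=.
have mf : measurable_fun setT (fun w => `|M w i j - ratr (z.1 i j)|).
  by apply: measurableT_comp => //; exact: measurable_funB.
rewrite (_ : [set w | _] = (fun w => `|M w i j - ratr (z.1 i j)|) @^-1` `]-oo, z.2.+1%:R^-1[%classic).
  by rewrite -[X in measurable X]setTI; exact: mf (measurable_itv _).
by apply/seteqP; split=> w /=; rewrite in_itv.
Qed.

(** The complement asks for one direction of the cone with a too small quadratic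
    form, an open condition on the matrix.  The matrix [Q0] serves to know that
    the cone is not trivial, since the cone does not depend on the matrix. *)
Lemma measurable_kappa2_ge (d : measure_display) (Omega : measurableType d) (N T p : nat)
    (lam mu c : R) (Q0 : 'M[R]_(p + N)) (M : Omega -> 'M[R]_(p + N)) (r1 r2 : nat) :
  0 < c -> 0 < kappa2 T lam mu Q0 r1 r2 ->
  (forall i j, measurable_fun setT (fun w => M w i j)) ->
  measurable [set w | c <= kappa2 T lam mu (M w) r1 r2].
Proof.
move=> c0 k0 mM.
pose U : set 'M[R]_(p + N) := [set Q | exists (d1 : 'cV[R]_p) (d2 : 'cV[R]_N)
    (R1 : {set 'I_p}) (R2 : {set 'I_N}),
  [/\ (#|R1| <= r1)%N, (#|R2| <= r2)%N, re_cone T lam mu d1 d2 R1 R2 &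
   ((col_mx d1 d2)^T *m Q *m col_mx d1 d2) 0 0 < c * l2norm (col_mx d1 d2) ^+ 2]].
rewrite (_ : [set w | _] = ~` (M @^-1` U)).
  apply: measurableC; apply: measurable_open_matrix => // Q [d1 [d2 [R1 [R2 [h1 h2 h3]]]]].
  set v := col_mx d1 d2; set gap := c * _ ^+ 2 => h4.
  have l0 : 0 < 1 + l1norm v ^+ 2 by rewrite ltr_pwDl// sqr_ge0.
  exists ((gap - (v^T *m Q *m v) 0 0) / (2 * (1 + l1norm v ^+ 2))).
    by rewrite divr_gt0 ?mulr_gt0// subr_gt0.
  move=> Q' hQ'; exists d1, d2, R1, R2; split=> //; rewrite -/v -/gap.
  have := quad_form_perturb v hQ'; rewrite ler_norml => /andP[_].
  set g := gap - _; have g0 : 0 < g by rewrite subr_gt0.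
  have : g / (2 * (1 + l1norm v ^+ 2)) * l1norm v ^+ 2 <= g / 2.
    have -> : g / (2 * (1 + l1norm v ^+ 2)) * l1norm v ^+ 2 =
        g / 2 * (l1norm v ^+ 2 / (1 + l1norm v ^+ 2)).
      by field; rewrite gt_eqF.
    rewrite ler_piMr ?divr_ge0 ?(ltW g0)//.
    by rewrite ler_pdivrMr// mul1r lerDr.
  rewrite /g in g0 *; lra.
apply/seteqP; split => w /=.
  move=> h [d1 [d2 [R1 [R2 [h1 h2 h3]]]]]; apply/negP; rewrite -leNgt.
  apply: le_trans (kappa2_le (lt_le_trans c0 h) h1 h2 h3).
  by rewrite ler_wpM2r// sqr_ge0.
move=> h; have [d1 [d2 [R1 [R2 [h1 h2 h3 h4]]]]] := kappa2_nonempty k0.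
apply: lb_le_inf; first by eexists; exists d1, d2, R1, R2; split.
move=> {d1 d2 R1 R2 h1 h2 h3 h4} q [d1 [d2 [R1 [R2 [dn0 c1 c2 cone ->]]]]].
have n0 : 0 < l2norm (col_mx d1 d2) ^+ 2.
  by rewrite exprn_gt0// lt_def l2norm_ge0 l2norm_eq0 dn0.
rewrite ler_pdivlMr// leNgt; apply/negP => hlt; apply: h.
by exists d1, d2, R1, R2.
Qed.

End PanelLasso.

(** * Random variables with finite moments *)

Section FiniteMoments.
Context d (Omega : measurableType d) (R : realType) (P : probability Omega R).
Implicit Types f g : Omega -> R.

(** Everything below is polynomial in subgaussian variables.  This class is closed
    under sums and products, so all integrability conditions follow from closure
    properties. *)
Definition finite_moments f : Prop :=
  measurable_fun setT f /\
  forall n, P.-integrable setT (fun w => (`|f w| ^+ n)%:E).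

Local Notation "''Ex' f" := (Rintegral P setT f) (at level 10, f at level 8).

Lemma integrable_dominated f g : measurable_fun setT f ->
  (forall w, `|f w| <= g w) -> P.-integrable setT (EFin \o g) ->
  P.-integrable setT (EFin \o f).
Proof.
move=> mf fg; apply: le_integrable => //; first exact/measurable_EFinP.
by move=> w _ /=; rewrite lee_fin (le_trans (fg w))// ler_norm.
Qed.

Lemma finite_moments_integrable f : finite_moments f ->
  P.-integrable setT (EFin \o f).
Proof.
move=> [mf /(_ 1%N)]; exact: integrable_dominated.
Qed.

Lemma finite_moments_measurable f : finite_moments f -> measurable_fun setT f.
Proof. by case. Qed.

Lemma finite_moments_cst c : finite_moments (cst c).
Proof.
split=> [//|n]; exact: (finite_measure_integrable_cst P (`|c| ^+ n)).
Qed.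

Lemma finite_momentsD f g : finite_moments f -> finite_moments g ->
  finite_moments (f \+ g).
Proof.
move=> [mf If] [mg Ig]; split; first exact: measurable_funD.
move=> n; apply: (@integrable_dominated _
    (fun w => 2 ^+ n * `|f w| ^+ n + 2 ^+ n * `|g w| ^+ n)).
- by apply: measurable_funX; apply: measurableT_comp => //; exact: measurable_funD.
- move=> w; rewrite ger0_norm ?exprn_ge0//.
  have := @addr_pow_split R n 1 `|f w| `|g w| ltr01 (normr_ge0 _) (normr_ge0 _).
  rewrite invr1 => /(le_trans _) -> //.
  by rewrite lerXn2r ?nnegrE ?addr_ge0// ler_normD.
- have -> : (EFin \o fun w => 2 ^+ n * `|f w| ^+ n + 2 ^+ n * `|g w| ^+ n) =
     (fun w => (2 ^+ n)%:E * (`|f w| ^+ n)%:E + (2 ^+ n)%:E * (`|g w| ^+ n)%:E)%E.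
    by apply/funext => w.
  by apply: integrableD => //; apply: integrableZl.
Qed.

Lemma finite_momentsM f g : finite_moments f -> finite_moments g ->
  finite_moments (f \* g).
Proof.
move=> [mf If] [mg Ig]; split; first exact: measurable_funM.
move=> n; apply: (@integrable_dominated _
    (fun w => `|f w| ^+ (n * 2) + `|g w| ^+ (n * 2))).
- by apply: measurable_funX; apply: measurableT_comp => //; exact: measurable_funM.
- move=> w; rewrite ger0_norm ?exprn_ge0//= normrM exprMn !exprM.
  set u : R := _ ^+ n; set v : R := `|g w| ^+ n.
  have : 0 <= u by rewrite exprn_ge0.
  have : 0 <= v by rewrite exprn_ge0.
  nra.
- have -> : (EFin \o fun w => `|f w| ^+ (n * 2) + `|g w| ^+ (n * 2)) =
     (fun w => (`|f w| ^+ (n * 2))%:E + (`|g w| ^+ (n * 2))%:E)%E.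
    by apply/funext => w.
  by apply: integrableD.
Qed.

Lemma finite_momentsZ c f : finite_moments f -> finite_moments (fun w => c * f w).
Proof. by move=> hf; exact: (finite_momentsM (finite_moments_cst c) hf). Qed.

Lemma finite_momentsX f n : finite_moments f -> finite_moments (fun w => f w ^+ n).
Proof.
move=> hf; elim: n => [|n IH].
  rewrite (_ : (fun w => _) = cst 1); first exact: finite_moments_cst.
  by apply/funext => w; rewrite expr0.
rewrite (_ : (fun w => _) = f \* (fun w => f w ^+ n)).
  exact: finite_momentsM.
by apply/funext => w; rewrite exprS.
Qed.

Lemma finite_moments_norm f : finite_moments f -> finite_moments (fun w => `|f w|).
Proof.
move=> [mf fi]; split; first exact: measurableT_comp.
by move=> n; under eq_fun do rewrite normr_id.
Qed.

Lemma finite_moments_sum (I : Type) (s : seq I) (p : pred I) (F : I -> Omega -> R) :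
  (forall i, finite_moments (F i)) ->
  finite_moments (fun w => \sum_(i <- s | p i) F i w).
Proof.
move=> hF; elim: s => [|i s IH].
  rewrite (_ : (fun w => _) = cst 0); first exact: finite_moments_cst.
  by apply/funext => w; rewrite big_nil.
rewrite (_ : (fun w => _) =
  if p i then F i \+ (fun w => \sum_(j <- s | p j) F j w)
  else (fun w => \sum_(j <- s | p j) F j w)).
  by case: (p i) => //; exact: finite_momentsD.
by apply/funext => w; rewrite big_cons; case: (p i).
Qed.

Lemma finite_moments_indic (A : set Omega) : measurable A -> finite_moments (\1_A).
Proof.
move=> mA; split; first exact: measurable_indic.
move=> n; apply: (@integrable_dominated _ (cst 1)).
- by apply: measurable_funX; apply: measurableT_comp => //; exact: measurable_indic.
- move=> w; rewrite ger0_norm ?exprn_ge0// indicE.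
  by case: (w \in A); rewrite ?normr1 ?normr0 ?expr1n//= exprn_ile1.
- exact: (finite_measure_integrable_cst P 1).
Qed.

Lemma expectD f g : finite_moments f -> finite_moments g ->
  'Ex (fun w => f w + g w) = 'Ex f + 'Ex g.
Proof.
by move=> /finite_moments_integrable ? /finite_moments_integrable ?; exact: RintegralD.
Qed.

Lemma expectZ c f : finite_moments f -> 'Ex (fun w => c * f w) = c * 'Ex f.
Proof. by move=> /finite_moments_integrable ?; exact: RintegralZl. Qed.

Lemma expect_le f g : finite_moments f -> finite_moments g ->
  (forall w, f w <= g w) -> 'Ex f <= 'Ex g.
Proof.
move=> /finite_moments_integrable ? /finite_moments_integrable ? fg.
by apply: le_Rintegral => // w _.
Qed.

Lemma expect_cst c : 'Ex (fun=> c) = c.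
Proof.
rewrite Rintegral_cst// (_ : fine _ = 1) ?mulr1//; exact: (congr1 fine (probability_setT P)).
Qed.

Lemma expect_sum (I : Type) (s : seq I) (p : pred I) (F : I -> Omega -> R) :
  (forall i, finite_moments (F i)) ->
  'Ex (fun w => \sum_(i <- s | p i) F i w) = \sum_(i <- s | p i) 'Ex (F i).
Proof.
move=> hF; elim: s => [|i s IH].
  rewrite big_nil -[RHS](expect_cst 0); congr Rintegral.
  by apply/funext => w; rewrite big_nil.
rewrite big_cons; have [pi|npi] := boolP (p i).
  rewrite -IH -expectD//; last exact: finite_moments_sum.
  by congr Rintegral; apply/funext => w; rewrite big_cons pi.
by rewrite -IH; congr Rintegral; apply/funext => w; rewrite big_cons (negbTE npi).
Qed.

(** * Moments and tails of martingale sums *)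

Definition sum_moment_cst : R := 128 * expR (4 * expR 2).

Lemma sum_moment_cst_ge1 : 1 <= sum_moment_cst.
Proof.
have : 1 <= expR (4 * expR 2) :> R by rewrite -[leLHS]expR0 ler_expR mulr_ge0 ?expR_ge0.
rewrite /sum_moment_cst; lra.
Qed.

(** The increments are indexed by a finite type with a rank rather than by
    integers, so that the same lemma serves single sums over units or periods and the
    double sum over the panel. *)
Lemma even_moment_sum (I : finType) (rk : I -> nat) (X : I -> Omega -> R)
    (m n : nat) (M : R) :
  injective rk -> (forall i, (rk i < n)%N) -> (0 < m)%N -> 0 <= M ->
  (forall i, finite_moments (X i)) ->
  (forall i, 'Ex (fun w => (\sum_(j | (rk j < rk i)%N) X j w) ^+ (2 * m).-1 * X i w) = 0) ->
  (forall i, 'Ex (fun w => X i w ^+ (2 * m)) <= M) ->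
  'Ex (fun w => (\sum_i X i w) ^+ (2 * m)) <= (sum_moment_cst * m%:R * n%:R) ^+ m * M.
Proof.
move=> rk_inj rkn m0 M0 hX orth hM.
(* With fewer terms than the exponent, convexity alone gives the bound. *)
have [mn|nm] := leqP m n; last first.
  have cI : (#|I| <= n)%N.
    rewrite -[leqRHS]card_ord; apply: (@leq_card _ _ (fun i => Ordinal (rkn i))).
    by move=> i j [] /rk_inj.
  have mE : (2 * m = (2 * m).-1.+1)%N by rewrite prednK// muln_gt0.
  have nn0 : (0 : R) <= n%:R by [].
  apply: (@le_trans _ _ ('Ex (fun w => n%:R ^+ (2 * m).-1 * \sum_i X i w ^+ (2 * m)))).
    apply: expect_le.
    - by apply: finite_momentsX; exact: finite_moments_sum.
    - by apply: finite_momentsZ; apply: finite_moments_sum => i; exact: finite_momentsX.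
    move=> w; have h0 := normr_ge0 (\sum_i X i w).
    apply: (@le_trans _ _ ((\sum_i `|X i w|) ^+ (2 * m))).
      rewrite !exprM -(real_normK (num_real (\sum_i X i w))).
      rewrite -!exprM lerXn2r ?nnegrE// ?sumr_ge0// ler_norm_sum//.
    rewrite {1}mE; apply: (le_trans (power_meanT _ _)) => //.
    rewrite -mE; have -> : \sum_i `|X i w| ^+ (2 * m) = \sum_i X i w ^+ (2 * m).
      by apply: eq_bigr => i _; rewrite !exprM real_normK ?num_real.
    apply: ler_wpM2r; first by apply: sumr_ge0 => i _; rewrite exprM exprn_ge0// sqr_ge0.
    by rewrite lerXn2r ?nnegrE// ler_nat.
  rewrite expectZ; last by apply: finite_moments_sum => i; exact: finite_momentsX.
  rewrite expect_sum; last by move=> i; exact: finite_momentsX.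
  apply: (@le_trans _ _ (n%:R ^+ (2 * m).-1 * (n%:R * M))).
    rewrite ler_wpM2l ?exprn_ge0//.
    apply: (@le_trans _ _ (\sum_(i : I) M)); first by apply: ler_sum => i _; exact: hM.
    by rewrite sumr_const -[M *+ _]mulr_natl ler_wpM2r// ler_nat.
  rewrite mulrA -exprSr -mE ler_wpM2r//.
  rewrite exprM lerXn2r ?nnegrE ?mulr_ge0//.
  rewrite expr2 ler_wpM2r//.
  apply: (@le_trans _ _ m%:R); first by rewrite ler_nat ltnW.
  by rewrite ler_peMl// sum_moment_cst_ge1.
have n0 : (0 < n)%N by exact: leq_trans mn.
pose S k w := \sum_(i | (rk i < k)%N) X i w.
have hS k : finite_moments (S k) by exact: finite_moments_sum.
(* The moments satisfy f (k+1) <= g f k + D M, and g^n is at most exp(O(m)). *)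
pose g : R := 1 + 4 * expR 2 * (m%:R / n%:R).
pose D : R := 8 * m%:R ^+ 2 * (4 * m%:R) ^+ m * n%:R ^+ m.-1.
have mn0 : 0 <= m%:R / n%:R :> R by rewrite divr_ge0.
have g1 : 1 <= g by rewrite lerDl mulr_ge0// mulr_ge0// expR_ge0.
have D0 : 0 <= D by rewrite !mulr_ge0 ?exprn_ge0.
have step k : 'Ex (fun w => S k.+1 w ^+ (2 * m)) <= g * 'Ex (fun w => S k w ^+ (2 * m)) + D * M.
  have Sk0 : 0 <= 'Ex (fun w => S k w ^+ (2 * m)).
    by apply: Rintegral_ge0 => w _; rewrite exprM exprn_ge0// sqr_ge0.
  have [i /eqP ik|noi] := pickP (fun i => rk i == k); last first.
    rewrite (_ : S k.+1 = S k).
      apply: (@le_trans _ _ (g * 'Ex (fun w => S k w ^+ (2 * m)))).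
        by rewrite ler_peMl.
      by rewrite lerDl mulr_ge0.
    apply/funext => w; apply: eq_bigl => j.
    by rewrite ltnS leq_eqVlt noi.
  have SE w : S k.+1 w = S k w + X i w.
    rewrite /S (bigD1 i) ?ik//= addrC; congr (_ + _); apply: eq_bigl => j.
    rewrite ltnS leq_eqVlt; have [jk|jk] /= := eqVneq (rk j) k.
      by rewrite jk ltnn; apply/negbTE; rewrite negbK -(inj_eq rk_inj) jk ik.
    by case: ltnP => //= jk'; rewrite -(inj_eq rk_inj) ik jk.
  apply: (@le_trans _ _ ('Ex (fun w => (g * S k w ^+ (2 * m) +
      (2 * m)%:R * (S k w ^+ (2 * m).-1 * X i w)) + D * X i w ^+ (2 * m)))).
    apply: expect_le.
    - exact: finite_momentsX.
    - apply: finite_momentsD; first apply: finite_momentsD.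
      + by apply: finite_momentsZ; exact: finite_momentsX.
      + by apply: finite_momentsZ; apply: finite_momentsM => //; exact: finite_momentsX.
      + by apply: finite_momentsZ; exact: finite_momentsX.
    - move=> w; rewrite SE mulrA; exact: even_power_increment.
  rewrite expectD; last 2 first.
  - apply: finite_momentsD.
    + by apply: finite_momentsZ; exact: finite_momentsX.
    + by apply: finite_momentsZ; apply: finite_momentsM => //; exact: finite_momentsX.
  - by apply: finite_momentsZ; exact: finite_momentsX.
  rewrite expectD; last 2 first.
  - by apply: finite_momentsZ; exact: finite_momentsX.
  - by apply: finite_momentsZ; apply: finite_momentsM => //; exact: finite_momentsX.
  rewrite !expectZ; try exact: finite_momentsX; last first.
    by apply: finite_momentsM => //; exact: finite_momentsX.
  by rewrite {2}/S -ik orth mulr0 addr0 lerD2l ler_wpM2l.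
have rec k : 'Ex (fun w => S k w ^+ (2 * m)) <= g ^+ k * (k%:R * (D * M)).
  elim: k => [|k IH].
    rewrite mul0r mulr0 (_ : (fun w => _) = fun=> 0) ?expect_cst//.
    by apply/funext => w; rewrite /S big_pred0// expr0n muln_eq0/= eqn0Ngt m0.
  apply: (le_trans (step k)).
  have := ler_wpM2l (le_trans ler01 g1) IH; rewrite [leRHS]mulrA -exprS => h.
  have -> : g ^+ k.+1 * (k.+1%:R * (D * M)) =
      g ^+ k.+1 * (k%:R * (D * M)) + g ^+ k.+1 * (D * M).
    by rewrite -(natr1 k); ring.
  apply: lerD => //; by rewrite ler_peMl ?mulr_ge0// exprn_ege1.
have -> : (fun w => (\sum_i X i w) ^+ (2 * m)) = (fun w => S n w ^+ (2 * m)).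
  by apply/funext => w; congr (_ ^+ _); apply: eq_bigl => i; rewrite rkn.
apply: (le_trans (rec n)).
rewrite [leLHS](_ : _ = (g ^+ n * (n%:R * D)) * M); last by ring.
rewrite ler_wpM2r//.
have nE : n%:R * D = 8 * m%:R ^+ 2 * (4 * m%:R * n%:R) ^+ m :> R.
  have nm : n%:R ^+ m = n%:R * n%:R ^+ m.-1 :> R by rewrite -exprS prednK.
  by rewrite /D [(_ * n%:R) ^+ m]exprMn nm; ring.
have gE : g ^+ n <= expR (4 * expR 2) ^+ m.
  apply: (le_trans (expr_le_expR _ _)).
    by rewrite (@le_trans _ _ 0)// mulr_ge0// mulr_ge0// expR_ge0.
  rewrite -expRM_natl ler_expR le_eqVlt; apply/orP; left; apply/eqP.
  by field; rewrite pnatr_eq0 -lt0n.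
rewrite nE.
apply: (@le_trans _ _ (expR (4 * expR 2) ^+ m * (32 ^+ m * (4 * m%:R * n%:R) ^+ m))).
  apply: ler_pM => //.
    by rewrite exprn_ge0// (le_trans ler01).
  rewrite ler_wpM2r ?exprn_ge0// ?mulr_ge0//.
  rewrite (_ : 32 = 8 * 2 ^+ 2); last by ring.
  rewrite exprMn; apply: ler_pM => //.
    by rewrite -[leLHS]expr1 ler_eXn2l// ltr1n.
  by rewrite exprAC lerXn2r ?nnegrE ?exprn_ge0// -natrX ler_nat ltnW// ltn_expl.
rewrite -!exprMn /sum_moment_cst; rewrite le_eqVlt; apply/orP; left; apply/eqP; congr (_ ^+ _); ring.
Qed.

Local Notation Pr A := (fine (P A)).

Lemma measurable_superlevel f c : measurable_fun setT f ->
  measurable [set w | c < f w].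
Proof.
move=> mf; rewrite (_ : [set w | _] = f @^-1` `]c, +oo[%classic).
  by rewrite -[X in measurable X]setTI; exact: mf (measurable_itv _).
by apply/seteqP; split=> w /=; rewrite in_itv /= andbT.
Qed.

Lemma prE A : measurable A -> P A = (Pr A)%:E.
Proof. by move=> mA; rewrite fineK// fin_num_measure. Qed.

Lemma pr_le1 A : measurable A -> Pr A <= 1.
Proof. by move=> mA; rewrite -lee_fin -prE// probability_le1. Qed.

Lemma expect_indic A : measurable A -> 'Ex (\1_A) = Pr A.
Proof. by move=> mA; rewrite /Rintegral integral_indic// setIT. Qed.

Lemma markov_moments (A : set Omega) g c : measurable A -> 0 < c ->
  finite_moments g -> (forall w, 0 <= g w) -> (forall w, A w -> c <= g w) ->
  Pr A <= 'Ex g / c.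
Proof.
move=> mA c0 hg g0 Ag; rewrite ler_pdivlMr// mulrC -expect_indic// -expectZ; last first.
  exact: finite_moments_indic.
apply: expect_le => //; first by apply: finite_momentsZ; exact: finite_moments_indic.
move=> w; rewrite indicE; have [/set_mem wA|_] := boolP (w \in A).
  by rewrite mulr1 Ag.
by rewrite mulr0.
Qed.

(** Markov's inequality at the exponent [m = truncn th], for which the moment
    bound divided by the threshold is at most [expR (- m)]; rounding costs the
    factor [expR 1]. *)
Lemma moment_tail f (H V k v th : R) : finite_moments f ->
  0 < H -> 0 < V -> 1 <= k -> 0 < v -> 0 <= th ->
  (forall m, (0 < m)%N ->
    'Ex (fun w => f w ^+ (2 * m)) <= (H * m%:R ^+ 3 * V) ^+ m * k) ->
  expR 1 * H * th ^+ 3 <= v ->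
  Pr [set w | V * v < f w ^+ 2] <= k * expR 1 * expR (- th).
Proof.
move=> hf H0 V0 k1 v0 th0 hm hv.
have mA : measurable [set w | V * v < f w ^+ 2].
  exact: measurable_superlevel (finite_moments_measurable (finite_momentsX 2 hf)).
have k0 : 0 <= k by exact: le_trans k1.
have /andP[m_le m_gt] := truncn_itv th0; set m := Num.truncn th in m_le m_gt.
(* For th < 1 the bound exceeds 1. *)
have [m0|m0] := posnP m.
  apply: (le_trans (pr_le1 mA)); rewrite -mulrA -expRD.
  have : 1 <= expR (1 - th) by rewrite -[leLHS]expR0 ler_expR subr_ge0 ltW// (lt_le_trans m_gt)// m0.
  by move=> h; rewrite -[leLHS]mulr1 ler_pM.
have Vv0 : 0 < (V * v) ^+ m by rewrite exprn_gt0 ?mulr_gt0.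
apply: (@le_trans _ _ ('Ex (fun w => f w ^+ (2 * m)) / (V * v) ^+ m)).
  apply: markov_moments => //; first exact: finite_momentsX.
    by move=> w; rewrite exprM exprn_ge0// sqr_ge0.
  move=> w /= /ltW h; rewrite exprM lerXn2r ?nnegrE ?sqr_ge0//.
  by rewrite mulr_ge0// ltW.
apply: (@le_trans _ _ (expR (- 1) ^+ m * k)).
  rewrite ler_pdivrMr//; apply: (le_trans (hm m m0)).
  rewrite [leRHS]mulrAC ler_wpM2r// -exprMn lerXn2r ?nnegrE//.
  - by rewrite !mulr_ge0 ?exprn_ge0// ltW.
  - by rewrite !mulr_ge0 ?expR_ge0// ltW.
  rewrite [leRHS]mulrCA mulrC ler_wpM2l ?(ltW V0)// expRN ler_pdivlMl ?expR_gt0// mulrA.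
  apply: le_trans hv; rewrite ler_wpM2l ?mulr_ge0 ?expR_ge0 ?(ltW H0)//.
  by rewrite lerXn2r ?nnegrE.
rewrite mulrC -mulrA ler_wpM2l// -expRM_natl mulrN1 -expRD ler_expR.
by move: m_gt; rewrite -natr1; lra.
Qed.

(** * Orthogonality from independence and martingale differences *)

Section Extension.
Import HBSimple HBNNSimple.
Context (d' : measure_display) (E : measurableType d') (W : Omega -> E).
Hypothesis mW : measurable_fun setT W.
Variable Z : Omega -> R.
Hypothesis hZ : finite_moments Z.
Hypothesis orthW : forall B, measurable B -> 'Ex (fun w => \1_B (W w) * Z w) = 0.

Lemma finite_moments_indic_comp B : measurable B -> finite_moments (fun w => \1_B (W w)).
Proof.
move=> mB; rewrite (_ : (fun w => _) = \1_(W @^-1` B)).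
  by apply: finite_moments_indic; rewrite -[X in measurable X]setTI; exact: mW.
by apply/funext => w; rewrite !indicE.
Qed.

Let orth_sfun (g : {nnsfun E >-> R}) : 'Ex (fun w => g (W w) * Z w) = 0.
Proof.
rewrite (_ : (fun w => _) = (fun w => \sum_(y <- finmap.enum_fset (fset_set (range g)))
   y * (\1_(g @^-1` [set y]) (W w) * Z w))).
  rewrite expect_sum; last first.
    move=> y; apply: finite_momentsZ; apply: finite_momentsM => //.
    by apply: finite_moments_indic_comp; exact: measurable_funPTI.
  rewrite big1// => y _; rewrite expectZ; last first.
    by apply: finite_momentsM => //; apply: finite_moments_indic_comp; exact: measurable_funPTI.
  by rewrite orthW ?mulr0//; exact: measurable_funPTI.
apply/funext => w; rewrite fimfunE fsbig_finite//= mulr_suml; apply: eq_bigr => y _.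
by rewrite mulrA.
Qed.

Let orth_ge0 (h : E -> R) : measurable_fun setT h -> (forall e, 0 <= h e) ->
  finite_moments (h \o W) -> 'Ex (fun w => h (W w) * Z w) = 0.
Proof.
move=> mh h0 hh.
have mEh : measurable_fun setT (EFin \o h) by exact/measurable_EFinP.
pose g := nnsfun_approx measurableT mEh.
have gh n e : `|g n e| <= `|h e|.
  rewrite !ger0_norm//.
  rewrite /g nnsfun_approxE -lee_fin.
  by apply: (@le_approx _ _ _ setT (EFin \o h)) => // x _; rewrite /= lee_fin.
have hZi : finite_moments (fun w => h (W w) * Z w) by exact: finite_momentsM.
have mg n : measurable_fun setT (fun w => g n (W w) * Z w).
  apply: measurable_funM; last exact: finite_moments_measurable.
  by apply: measurableT_comp => //; exact: measurable_funPTI.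
have [] // := @dominated_convergence _ _ _ P setT measurableT
  (fun n w => (g n (W w) * Z w)%:E) (fun w => (h (W w) * Z w)%:E)
  (fun w => `|(h (W w) * Z w)%:E|%E).
- by move=> n; exact/measurable_EFinP.
- by apply/measurable_EFinP; exact: finite_moments_measurable.
- apply: aeW => w _; apply: cvg_EFin; first exact: nearW.
  apply: cvgM; last exact: cvg_cst.
  have := @cvg_nnsfun_approx _ _ _ _ measurableT _ mEh (fun x _ => h0 x) (W w) Logic.I.
  by move/fine_cvg.
- by apply: integrable_abse; exact: finite_moments_integrable.
- apply: aeW => w n _ /=; rewrite lee_fin !normrM ler_wpM2r//.
move=> _ _ /= hc.
have g0 n : (\int[P]_w (g n (W w) * Z w)%:E = 0)%E.
  have gi : P.-integrable setT (fun w => (g n (W w) * Z w)%:E).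
    apply: (@integrable_dominated _ (fun w => `|h (W w) * Z w|)) => //.
      by move=> w; rewrite !normrM ler_wpM2r.
    exact: finite_moments_integrable (finite_moments_norm hZi).
  rewrite -[LHS]fineK; last exact: integrable_fin_num gi.
  by congr EFin; exact: orth_sfun.
move: hc; under eq_fun do rewrite g0.
move=> /cvg_lim; rewrite lim_cst// /Rintegral => <- //.
Qed.

(** This replaces conditional expectations: the hypothesis says that E[Z | W] = 0.
    It passes from indicators to simple functions by linearity, and to
    nonnegative functions by dominated convergence along an increasing
    approximation. *)
Lemma orthogonal_extension (h : E -> R) : measurable_fun setT h ->
  finite_moments (h \o W) -> 'Ex (fun w => h (W w) * Z w) = 0.
Proof.
move=> mh hh.
have pos (h' : E -> R) : measurable_fun setT h' -> finite_moments (h' \o W) ->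
  finite_moments (fun w => Num.max (h' (W w)) 0).
  move=> mh' [mhW hi]; split; first exact: measurable_maxr.
  move=> n; apply: (integrable_dominated _ _ (hi n)).
    by apply: measurable_funX; apply: measurableT_comp => //; exact: measurable_maxr.
  move=> w; rewrite ger0_norm ?exprn_ge0//= lerXn2r ?nnegrE//.
  by rewrite ger0_norm ?le_max ?lexx ?orbT// ge_max ler_norm normr_ge0.
have hN : finite_moments ((fun e => - h e) \o W).
  rewrite (_ : _ \o _ = fun w => (-1) * h (W w)); first exact: finite_momentsZ.
  by apply/funext => w /=; rewrite mulN1r.
have mhN : measurable_fun setT (fun e => - h e).
  by apply: measurableT_comp.
rewrite (_ : (fun w => _) = (fun w => Num.max (h (W w)) 0 * Z w +
    (-1) * (Num.max (- h (W w)) 0 * Z w))).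
  rewrite expectD; last 2 first.
  - by apply: finite_momentsM => //; exact: pos.
  - by apply: finite_momentsZ; apply: finite_momentsM => //; exact: (pos (fun e => - h e)).
  rewrite expectZ; last by apply: finite_momentsM => //; exact: (pos (fun e => - h e)).
  rewrite (orth_ge0 (h := fun e => Num.max (h e) 0)).
  - rewrite (orth_ge0 (h := fun e => Num.max (- h e) 0)) ?mulr0 ?addr0//.
    + exact: measurable_maxr.
    + by move=> e; rewrite le_max lexx orbT.
    + exact: (pos (fun e => - h e)).
  - exact: measurable_maxr.
  - by move=> e; rewrite le_max lexx orbT.
  - exact: pos.
apply/funext => w; rewrite mulrA mulN1r -mulrDl; congr (_ * _).
have [h0|/ltW h0] := leP 0 (h (W w)).
  by rewrite max_r ?subr0// oppr_le0.
by rewrite max_l ?oppr_ge0// sub0r opprK.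
Qed.

End Extension.

Lemma pr_indep (A1 A2 : set Omega) : measurable A1 -> measurable A2 ->
  P (A1 `&` A2) = (P A1 * P A2)%E -> Pr (A1 `&` A2) = Pr A1 * Pr A2.
Proof. by move=> m1 m2 ->; rewrite fineM// fin_num_measure. Qed.

(** Independence of an event and a map says that the centred indicator of the
    event is orthogonal to all indicators of the map. *)
Lemma indep_event_expect (d' : measure_display) (E : measurableType d')
    (W : Omega -> E) (A : set Omega) (g : E -> R) :
  measurable_fun setT W -> measurable A ->
  (forall B, measurable B -> P (A `&` W @^-1` B) = (P A * P (W @^-1` B))%E) ->
  measurable_fun setT g -> finite_moments (g \o W) ->
  'Ex (fun w => \1_A w * g (W w)) = Pr A * 'Ex (g \o W).
Proof.
move=> mW mA indep mg hg.
have hZ : finite_moments (fun w => \1_A w - Pr A).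
  by apply: finite_momentsD; [exact: finite_moments_indic|exact: finite_moments_cst].
have hA := finite_moments_indic mA.
have mB B : measurable B -> measurable (W @^-1` B).
  by move=> ?; rewrite -[X in measurable X]setTI; exact: mW.
have := fun H => @orthogonal_extension _ _ W mW _ hZ H g mg hg.
rewrite (_ : (fun w => g (W w) * _) =
    (fun w => \1_A w * g (W w) + (- Pr A) * (g \o W) w)); last first.
  by apply/funext => w /=; ring.
rewrite expectD ?expectZ//; last 2 first.
- exact: finite_momentsM.
- exact: finite_momentsZ.
move=> h; suff : 'Ex (fun w => \1_A w * g (W w)) + - Pr A * 'Ex (g \o W) = 0 by lra.
apply: h => B mB'.
rewrite (_ : (fun w => _) =
    (fun w => \1_(A `&` W @^-1` B) w + (- Pr A) * \1_(W @^-1` B) w)); last first.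
  apply/funext => w; rewrite indicI/= !indicE.
  rewrite (_ : (w \in W @^-1` B) = (W w \in B)); last by [].
  by ring.
have mWB := mB B mB'; have mAB := measurableI _ _ mA mWB.
have hWB := finite_moments_indic mWB; have hAB := finite_moments_indic mAB.
rewrite expectD ?expectZ ?expect_indic//; last exact: finite_momentsZ.
by rewrite pr_indep//; [ring|exact: indep].
Qed.

Lemma binomial_orth f g Z l : finite_moments f -> finite_moments g -> finite_moments Z ->
  (forall a b, 'Ex (fun w => f w ^+ a * (g w ^+ b * Z w)) = 0) ->
  'Ex (fun w => (f w + g w) ^+ l * Z w) = 0.
Proof.
move=> hf hg hZ h.
have hab a b : finite_moments (fun w => f w ^+ a * (g w ^+ b * Z w)).
  by apply: finite_momentsM; [|apply: finite_momentsM => //]; exact: finite_momentsX.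
rewrite (_ : (fun w => _) = (fun w => \sum_(i < l.+1)
    'C(l, i)%:R * (f w ^+ (l - i) * (g w ^+ i * Z w)))).
  rewrite expect_sum; last by move=> i; exact: finite_momentsZ.
  by rewrite big1// => i _; rewrite expectZ// h mulr0.
apply/funext => w; rewrite exprDn mulr_suml; apply: eq_bigr => i _.
by rewrite -mulr_natl; ring.
Qed.

Section IndependentUnits.
Context (d' : measure_display) (E : measurableType d') (I : finType).
Variables (W : I -> Omega -> E) (y : I -> E -> R).
Hypothesis mW : forall i, measurable_fun setT (W i).
Hypothesis my : forall i, measurable_fun setT (y i).
Hypothesis hy : forall i, finite_moments (y i \o W i).
Hypothesis indepW : mutually_independent P W.

Let cyl (J : {set I}) (B : I -> set E) := \bigcap_(j in [set` J]) (W j @^-1` B j).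

Let measurable_cyl (J : {set I}) (B : I -> set E) : (forall i, measurable (B i)) -> measurable (cyl J B).
Proof.
move=> mB; apply: fin_bigcap_measurable; first exact: finite_finset.
by move=> i _; rewrite -[X in measurable X]setTI; exact: mW.
Qed.

Lemma indep_cylinder (J : {set I}) (B : I -> set E) i0 : (forall i, measurable (B i)) -> i0 \notin J ->
  P (cyl J B `&` W i0 @^-1` B i0) = (P (cyl J B) * P (W i0 @^-1` B i0))%E.
Proof.
move=> mB iJ.
have -> : cyl J B `&` W i0 @^-1` B i0 = cyl (i0 |: J)%SET B.
  apply/seteqP; split => w /=.
    by move=> [h1 h2] j /=; rewrite !inE => /orP[/eqP ->//|/h1].
  by move=> h; split=> [j jJ|]; apply: h; rewrite /= !inE ?eqxx ?jJ ?orbT.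
by rewrite !indepW// big_setU1//= muleC.
Qed.

(** Induction on the number of units in the sum.  The unit [j0] is split off by the
    binomial theorem, and [orthogonal_extension] lets its power be replaced by an
    indicator, which joins the cylinder event carried by the induction.  When no unit
    is left, independence factors the expectation. *)
Lemma indep_sum_orth (i0 : I) (J : {set I}) l (g : E -> R) :
  i0 \notin J -> measurable_fun setT g -> finite_moments (g \o W i0) ->
  'Ex (g \o W i0) = 0 ->
  'Ex (fun w => (\sum_(j in J) y j (W j w)) ^+ l * g (W i0 w)) = 0.
Proof.
move=> iJ mg hg g0.
have hS (J2 : {set I}) : finite_moments (fun w => \sum_(j in J2) y j (W j w)).
  by apply: finite_moments_sum => j; exact: hy.
suff H n : forall (J1 J2 : {set I}) B k, #|J2| = n -> (forall i, measurable (B i)) ->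
    i0 \notin J1 -> i0 \notin J2 -> (forall j, j \in J1 -> j \notin J2) ->
    'Ex (fun w => (\sum_(j in J2) y j (W j w)) ^+ k * (\1_(cyl J1 B) w * g (W i0 w))) = 0.
  rewrite -[RHS](H _ finset.set0 J (fun=> setT) l erefl) ?inE//; last first.
    by move=> j; rewrite inE.
  congr Rintegral; apply/funext => w; rewrite indicE mem_set ?mul1r//.
elim: n => [|n IH] J1 J2 B k cJ mB iJ1 iJ2 dJ.
  have -> : J2 = finset.set0 by apply/eqP; rewrite -cards_eq0 cJ.
  under [X in Rintegral _ _ X]funext => w do rewrite big_set0.
  case: k => [|k]; last first.
    by rewrite -[RHS](expect_cst 0); congr Rintegral; apply/funext => w; rewrite expr0n mul0r.
  under [X in Rintegral _ _ X]funext => w do rewrite expr0 mul1r.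
  rewrite indep_event_expect ?g0 ?mulr0//; first exact: measurable_cyl.
  move=> C mC; have := @indep_cylinder J1 (fun j => if j == i0 then C else B j) i0.
  rewrite eqxx (_ : cyl J1 _ = cyl J1 B); last first.
    apply: eq_bigcapr => j /= jJ; case: eqP => // ji; by rewrite -ji jJ in iJ1.
  by apply => // j; case: ifP.
have [j0 j0J] : exists j, j \in J2 by apply/set0Pn; rewrite -card_gt0 cJ.
have j0J1 : j0 \notin J1 by apply/negP => /dJ; rewrite j0J.
pose rest w := \sum_(j in (J2 :\ j0)%SET) y j (W j w).
under [X in Rintegral _ _ X]funext => w do rewrite (big_setD1 j0)//=.
have hcyl J3 B3 : (forall i, measurable (B3 i)) -> finite_moments (\1_(cyl J3 B3)).
  by move=> ?; apply: finite_moments_indic; exact: measurable_cyl.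
apply: binomial_orth; [exact: hy|exact: hS| |].
  by apply: finite_momentsM => //; exact: hcyl.
move=> a b.
apply: (orthogonal_extension (mW j0) _ _ (h := fun e => y j0 e ^+ a)).
- apply: finite_momentsM; first exact: finite_momentsX.
  by apply: finite_momentsM => //; exact: hcyl.
- move=> C mC.
  have := IH (j0 |: J1)%SET (J2 :\ j0)%SET (fun j => if j == j0 then C else B j) b.
  move=> H; rewrite -[RHS]H; last 5 first.
  - by move: cJ; rewrite (cardsD1 j0) j0J => -[].
  - by move=> j; case: ifP.
  - by rewrite !inE negb_or iJ1 andbT; apply: contraNneq iJ2 => ->.
  - by rewrite !inE negb_and iJ2 orbT.
  - move=> j; rewrite !inE negb_and negbK => /orP[->//|/dJ ->].
    by rewrite orbT.
  congr Rintegral; apply/funext => w.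
  have -> : \1_(cyl (j0 |: J1)%SET (fun j => if j == j0 then C else B j)) w =
      \1_C (W j0 w) * \1_(cyl J1 B) w :> R.
    rewrite !indicE -natrM mulnb; congr (_%:R); congr nat_of_bool.
    apply/idP/andP => [/set_mem h|[/set_mem h1 /set_mem h2]].
      split; apply/mem_set.
        by have := h j0; rewrite /= !inE !eqxx; apply.
      move=> j /= jJ; have := h j; rewrite /= !inE jJ orbT => /(_ isT).
      by case: eqP => // jj0; rewrite -jj0 jJ in j0J1.
    apply/mem_set => j /=; rewrite !inE; case: eqP => [->//|_ /= jJ].
    exact: h2.
  by ring.
- by apply: measurable_funX; exact: my.
- exact: (finite_momentsX _ (hy j0)).
Qed.

End IndependentUnits.

Section UnitMartingale.
Context (d1 d2 : measure_display) (EU : measurableType d1) (EV : measurableType d2).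
Variables (T : nat) (U : Omega -> EU) (V : Omega -> EV).
Variables (xh : 'I_T -> EU -> R) (eh : 'I_T -> EV -> R) (e : 'I_T -> Omega -> R).
Hypothesis mU : measurable_fun setT U.
Hypothesis mV : measurable_fun setT V.
Hypothesis mxh : forall t, measurable_fun setT (xh t).
Hypothesis meh : forall t, measurable_fun setT (eh t).
Hypothesis hx : forall t, finite_moments (xh t \o U).
Hypothesis he : forall t, finite_moments (e t).
Hypothesis eE : forall t w, e t w = eh t (V w).
Hypothesis indepUV : independent_pair P U V.
Hypothesis mds : martingale_difference P (natural_filtration e) e.

Let past (s : nat) : set (set Omega) :=
  \bigcup_(t in [set t : 'I_T | (t < s)%N]) preimage_set_system setT (e t) measurable.

Lemma past_measurable s A : <<s past s >> A -> measurable A.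
Proof.
apply: (@smallest_sub _ (@sigma_algebra Omega setT)).
  exact: sigma_algebra_measurable.
by move=> B [t _ [C mC <-]]; apply: (finite_moments_measurable (he t)).
Qed.

(** The filtration is turned into a measurable type on the same set, so that
    functions of the past are measurable functions of the identity map. *)
Lemma martingale_orth (t : 'I_T) (h : g_sigma_algebraType (past t) -> R) :
  measurable_fun setT h -> finite_moments (h : Omega -> R) ->
  'Ex (fun w => h w * e t w) = 0.
Proof.
move=> mh hh.
have mid : measurable_fun setT (id : Omega -> g_sigma_algebraType (past t)).
  by move=> _ B mB; rewrite setTI preimage_id; exact: past_measurable mB.
apply: (orthogonal_extension mid (he t) _ mh hh) => B mB.
have [_ _ [_ _ /(_ B mB)]] := mds t.
rewrite [X in X = _]integral0 => h0; rewrite /Rintegral -[RHS]/(fine 0%E) h0.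
rewrite [in RHS]integral_mkcond; congr fine; apply: eq_integral => w _.
by rewrite patchE indicE /=; case: ifP => _; rewrite ?mul1r ?mul0r.
Qed.

(** Induction on the number of past periods in the sum.  A product [x_s e_s] split
    off by the binomial theorem is distributed: its covariate joins [hX], its error
    joins the function [kE] of the past errors.  When no period is left, the
    covariates are separated by their independence of the errors, and the
    martingale property applies. *)
Lemma unit_sum_orth (t : 'I_T) (J : {set 'I_T}) l (hX : EU -> R) (kE : EV -> R) :
  (forall s, s \in J -> (s < t)%N) ->
  measurable_fun setT hX -> finite_moments (hX \o U) ->
  measurable_fun setT kE -> finite_moments (kE \o V) ->
  measurable_fun setT (kE \o V : g_sigma_algebraType (past t) -> R) ->
  'Ex (fun w => (\sum_(s in J) xh s (U w) * e s w) ^+ l *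
        (hX (U w) * (kE (V w) * e t w))) = 0.
Proof.
move cJ : #|J| => n.
elim: n J l hX kE cJ => [|n IH] J l hX kE cJ Jt mX fX mE fE pE.
  have -> : J = finset.set0 by apply/eqP; rewrite -cards_eq0 cJ.
  under [X in Rintegral _ _ X]funext => w do rewrite big_set0.
  case: l => [|l]; last first.
    by rewrite -[RHS](expect_cst 0); congr Rintegral; apply/funext => w; rewrite expr0n mul0r.
  under [X in Rintegral _ _ X]funext => w do rewrite expr0 mul1r.
  have fke : finite_moments (fun w => kE (V w) * e t w) by exact: finite_momentsM.
  apply: (orthogonal_extension mU fke _ mX fX) => B mB.
  have mUB : measurable (U @^-1` B) by rewrite -[X in measurable X]setTI; exact: mU.
  have := @indep_event_expect _ _ V (U @^-1` B) (fun v => kE v * eh t v) mV mUB.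
  rewrite (_ : (fun w => \1_(U @^-1` B) w * _) =
      (fun w => \1_B (U w) * (kE (V w) * e t w))); last first.
    by apply/funext => w; rewrite eE !indicE.
  have fke' : finite_moments ((fun v => kE v * eh t v) \o V).
    by rewrite (_ : _ \o _ = fun w => kE (V w) * e t w)//; apply/funext => w; rewrite eE.
  move=> -> //; last 2 first.
  - by move=> B' mB'; exact: indepUV.
  - exact: measurable_funM.
  rewrite (_ : _ \o _ = fun w => kE (V w) * e t w); last by apply/funext => w; rewrite eE.
  by rewrite (@martingale_orth t (kE \o V)) ?mulr0.
have [s0 s0J] : exists s, s \in J by apply/set0Pn; rewrite -card_gt0 cJ.
under [X in Rintegral _ _ X]funext => w do rewrite (big_setD1 s0)//=.
have hS (K : {set 'I_T}) : finite_moments (fun w => \sum_(s in K) xh s (U w) * e s w).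
  by apply: finite_moments_sum => s; exact: finite_momentsM (hx s) (he s).
apply: binomial_orth; [exact: finite_momentsM (hx s0) (he s0)|exact: hS| |].
  by apply: finite_momentsM => //; exact: finite_momentsM.
move=> a b.
rewrite -[RHS](IH (J :\ s0)%SET b (fun u => hX u * xh s0 u ^+ a)
    (fun v => kE v * eh s0 v ^+ a)).
- by congr Rintegral; apply/funext => w; rewrite -(eE s0 w) exprMn; ring.
- by move: cJ; rewrite (cardsD1 s0) s0J => -[].
- by move=> s; rewrite !inE => /andP[_]; exact: Jt.
- by apply: measurable_funM => //; exact: measurable_funX.
- by apply: finite_momentsM => //; exact: (finite_momentsX a (hx s0)).
- by apply: measurable_funM => //; exact: measurable_funX.
- apply: finite_momentsM => //; rewrite (_ : (fun w => _) = (fun w => e s0 w ^+ a)).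
    exact: finite_momentsX.
  by apply/funext => w; rewrite /= eE.
- apply: measurable_funM => //; apply: measurable_funX.
  move=> _ B mB; rewrite setTI; apply: sub_sigma_algebra.
  exists s0; first exact: Jt.
  exists B => //; rewrite setTI; apply/seteqP; split=> w /=; by rewrite eE.
Qed.

End UnitMartingale.

(** * Moments of subgaussian variables *)

Section Subgaussian.
Variables (f : Omega -> R) (C K : R).
Hypothesis mf : measurable_fun setT f.
Hypothesis C0 : 0 < C.
Hypothesis K0 : 0 < K.
Hypothesis tail : forall u : R, 0 < u ->
  (P [set w | (u <= `|f w|)%R] <= (K / 2 * expR (- (C * u ^+ 2)))%:E)%E.

(** The sum of the geometric series that bounds E exp(C f^2 / 2). *)
Definition subgaussian_cst (K : R) : R := (1 + K / 2) * expR (2^-1) / (1 - expR (- 2^-1)).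

Let r : R := expR (- 2^-1).

Let r1 : r < 1.
Proof. by rewrite /r -[ltRHS]expR0 ltr_expR oppr_lt0 invr_gt0. Qed.

Lemma subgaussian_cst_ge1 : 1 <= subgaussian_cst K.
Proof.
rewrite /subgaussian_cst ler_pdivlMr ?subr_gt0//.
have h1 : 1 <= expR (2^-1) :> R by rewrite -[leLHS]expR0 ler_expR invr_ge0.
have h2 : 0 <= r by exact: expR_ge0.
have h3 : 1 * 1 <= (1 + K / 2) * expR (2^-1) by apply: ler_pM => //; rewrite lerDl divr_ge0// (ltW K0).
by rewrite -/r; lra.
Qed.

Let level k := [set w | k%:R <= C * f w ^+ 2].

Let measurable_level k : measurable (level k).
Proof.
have mg : measurable_fun setT (fun w => C * f w ^+ 2).
  by apply: measurable_funM => //; exact: measurable_funX.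
rewrite (_ : level k = (fun w => C * f w ^+ 2) @^-1` `[k%:R, +oo[%classic).
  by rewrite -[X in measurable X]setTI; exact: mg (measurable_itv _).
by apply/seteqP; split=> w /=; rewrite in_itv /= andbT.
Qed.

Let level_tail k : (P (level k) <= ((1 + K / 2) * expR (- k%:R))%:E)%E.
Proof.
case: k => [|k].
  apply: (le_trans (probability_le1 P (measurable_level 0))).
  by rewrite lee_fin oppr0 expR0 mulr1 lerDl divr_ge0// ltW.
set u := Num.sqrt (k.+1%:R / C).
have u2 : u ^+ 2 = k.+1%:R / C by rewrite sqr_sqrtr// divr_ge0// ltW.
have u0 : 0 < u by rewrite sqrtr_gt0 divr_gt0.
have -> : level k.+1 = [set w | (u <= `|f w|)%R].
  apply/seteqP; split=> w /=.
    move=> h; rewrite -(@ler_pXn2r _ 2)// ?nnegrE ?normr_ge0 ?(ltW u0)//.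
    by rewrite u2 real_normK ?num_real// ler_pdivrMr// mulrC.
  move=> h; rewrite /level /= mulrC -ler_pdivrMr// -u2 -(real_normK (num_real (f w))).
  by rewrite lerXn2r ?nnegrE ?(ltW u0).
apply: (le_trans (tail u0)); rewrite lee_fin u2 mulrC [C * _]mulrC divfK ?gt_eqF//.
by rewrite mulrC ler_wpM2r ?expR_ge0//; lra.
Qed.

(** The exponential is bounded by a series over the levels k <= C f^2, whose k-th term
    exp((k+1)/2) P(C f^2 >= k) decays like exp(-k/2). *)
Lemma subgaussian_expR_integral :
  (\int[P]_w (expR (C / 2 * f w ^+ 2))%:E <= (subgaussian_cst K)%:E)%E.
Proof.
pose u k w : \bar R := (expR (k.+1%:R / 2) * \1_(level k) w)%:E.
have u0 k w : (0 <= u k w)%E by rewrite lee_fin mulr_ge0 ?expR_ge0// indicE.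
have mu_ k : measurable_fun setT (u k).
  by apply/measurable_EFinP; apply: measurable_funM.
apply: (@le_trans _ _ (\int[P]_w (\sum_(k <oo) u k w)%E)%E).
  apply: ge0_le_integral => //.
  - apply/measurable_EFinP; apply: measurableT_comp => //.
    by apply: measurable_funM => //; exact: measurable_funX.
  - by apply: ge0_emeasurable_sum => //.
  move=> w _; have h0 : 0 <= C * f w ^+ 2 by rewrite mulr_ge0 ?sqr_ge0// ltW.
  have /andP[h1 h2] := truncn_itv h0; set k := Num.truncn _ in h1 h2.
  apply: (@le_trans _ _ (\sum_(0 <= i < k.+1) u i w)%E); last exact: nneseries_lim_ge.
  rewrite big_nat_recr//=; apply: (@le_trans _ _ (u k w)); last first.
    by rewrite leeDr// sume_ge0.
  rewrite /u indicE mem_set// mulr1 lee_fin ler_expR.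
  by rewrite mulrAC ler_wpM2r ?invr_ge0// ltW.
rewrite integral_nneseries//.
apply: lime_le.
  by apply: is_cvg_nneseries => k _ _; apply: integral_ge0.
apply: nearW => n.
apply: (@le_trans _ _ (\sum_(0 <= k < n) ((1 + K / 2) * expR (2^-1) * r ^+ k)%:E)%E).
  apply: lee_sum => k _; rewrite /u.
  under eq_integral do rewrite EFinM.
  rewrite ge0_integralZl//; last by exact/measurable_EFinP/measurable_indic.
  rewrite integral_indic ?setIT//.
  apply: (@le_trans _ _ ((expR (k.+1%:R / 2))%:E * ((1 + K / 2) * expR (- k%:R))%:E)%E).
    by apply: lee_wpmul2l; [rewrite lee_fin expR_ge0|exact: level_tail].
  rewrite -EFinM lee_fin /r -expRM_natl mulrCA -mulrA -!expRD.
  rewrite (_ : k.+1%:R / 2 - k%:R = 2^-1 + k%:R * - 2^-1)// -natr1; lra.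
rewrite sumEFin lee_fin -mulr_sumr /subgaussian_cst.
rewrite ler_wpM2l ?mulr_ge0 ?expR_ge0 ?addr_ge0 ?divr_ge0 ?(ltW K0)//.
rewrite -[leRHS]mul1r ler_pdivlMr ?subr_gt0// -/r.
have := @geometric_seriesE R 1 r; rewrite lt_eqF// => /(_ isT) /(congr1 (@^~ n)) /=.
rewrite /series /= /geometric; under eq_bigr do rewrite mul1r.
move=> ->; rewrite divfK ?subr_eq0 1?eq_sym ?lt_eqF// mul1r.
by rewrite gerBl exprn_ge0 ?expR_ge0.
Qed.

Lemma pow_le_expR (m : nat) (x : R) : (0 < m)%N -> 0 <= x -> x ^+ m <= m%:R ^+ m * expR x.
Proof.
move=> m0 x0; have m0' : (0 : R) < m%:R by rewrite ltr0n.
rewrite -ler_pdivrMl ?exprn_gt0// mulrC -expr_div_n.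
rewrite [x in expR x](_ : _ = m%:R * (x / m%:R)); last by field; rewrite gt_eqF.
rewrite expRM_natl lerXn2r ?nnegrE ?expR_ge0 ?divr_ge0 ?(ltW m0')//.
by apply: le_trans (expR_ge1Dx _); rewrite lerDr.
Qed.

Lemma subgaussian_integrable m : (0 < m)%N ->
  P.-integrable setT (fun w => (f w ^+ (2 * m))%:E) /\
  \int[P]_w (f w ^+ (2 * m)) <= (2 * m%:R / C) ^+ m * subgaussian_cst K.
Proof.
move=> m0; have m0' : (0 : R) < m%:R by rewrite ltr0n.
have g0 w : 0 <= f w ^+ (2 * m) by rewrite exprM exprn_ge0 ?sqr_ge0.
have mg : measurable_fun setT (fun w => (f w ^+ (2 * m))%:E).
  by apply/measurable_EFinP; exact: measurable_funX.
have me : measurable_fun setT (fun w => (expR (C / 2 * f w ^+ 2))%:E).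
  apply/measurable_EFinP; apply: measurableT_comp => //.
  by apply: measurable_funM => //; exact: measurable_funX.
have c0 : 0 <= (2 * m%:R / C) ^+ m by rewrite exprn_ge0// divr_ge0 ?mulr_ge0 ?(ltW C0).
have bnd : (\int[P]_w (f w ^+ (2 * m))%:E <=
    ((2 * m%:R / C) ^+ m * subgaussian_cst K)%:E)%E.
  apply: (@le_trans _ _ (\int[P]_w (((2 * m%:R / C) ^+ m)%:E *
      (expR (C / 2 * f w ^+ 2))%:E))%E).
    apply: ge0_le_integral => //.
    - by move=> w _; rewrite lee_fin.
    - exact: measurable_funeM.
    move=> w _; rewrite -EFinM lee_fin.
    have h0 : 0 <= C / 2 * f w ^+ 2 by rewrite mulr_ge0 ?sqr_ge0 ?divr_ge0 ?(ltW C0).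
    have := pow_le_expR m0 h0; rewrite exprMn -exprM => h.
    have := ler_wpM2l (_ : 0 <= (2 / C) ^+ m) h.
    rewrite exprn_ge0 ?divr_ge0 ?(ltW C0)// => /(_ isT).
    rewrite mulrA -exprMn (_ : 2 / C * (C / 2) = 1) ?expr1n ?mul1r; last first.
      by field; rewrite gt_eqF.
    by rewrite mulrA -exprMn (_ : 2 / C * m%:R = 2 * m%:R / C)//; ring.
  rewrite ge0_integralZl// EFinM; apply: lee_wpmul2l; first by rewrite lee_fin.
  exact: subgaussian_expR_integral.
split.
  apply/integrableP; split=> //.
  under eq_integral do rewrite gee0_abs ?lee_fin//.
  by apply: le_lt_trans bnd _; rewrite ltry.
rewrite -lee_fin /Rintegral fineK//.
rewrite ge0_fin_numE; first by apply: le_lt_trans bnd _; rewrite ltry.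
by apply: integral_ge0 => w _; rewrite lee_fin.
Qed.

Lemma subgaussian_finite_moments : finite_moments f.
Proof.
split=> // n; apply: (@integrable_dominated _ (fun w => 1 + f w ^+ (2 * n.+1))).
- by apply: measurable_funX; exact: measurableT_comp.
- move=> w; rewrite ger0_norm ?exprn_ge0// exprM -(real_normK (num_real (f w))) -exprM.
  have h0 := normr_ge0 (f w); set a := `|f w| in h0 *.
  have [a1|/ltW a1] := leP a 1.
    by apply: (@le_trans _ _ 1); [rewrite exprn_ile1|rewrite lerDl exprn_ge0].
  apply: (@le_trans _ _ (a ^+ (2 * n.+1))); last by rewrite lerDr.
  by rewrite ler_weXn2l// mul2n -addnn (leq_trans (leqnSn n))// leq_addr.
- rewrite (_ : EFin \o _ = (fun w => 1%:E + (f w ^+ (2 * n.+1))%:E)%E); last by apply/funext.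
  apply: integrableD => //; first exact: (finite_measure_integrable_cst P 1).
  by have [] := @subgaussian_integrable n.+1 isT.
Qed.

End Subgaussian.

Lemma measurable_sum_cond (d' : measure_display) (E : measurableType d') (I : finType)
    (q : pred I) (F : I -> E -> R) :
  (forall i, q i -> measurable_fun setT (F i)) ->
  measurable_fun setT (fun z => \sum_(i | q i) F i z).
Proof.
move=> mF; rewrite (_ : (fun z => _) = fun z => \sum_i (if q i then F i z else 0)).
  by apply: measurable_sum => i; case: (boolP (q i)) => [/mF//|_]; exact: measurable_cst.
by apply/funext => z; rewrite big_mkcond.
Qed.

(** From (f g)^(2m) <= (f^(4m) + g^(4m)) / 2. *)
Lemma product_moment f g m D : finite_moments f -> finite_moments g ->
  'Ex (fun w => f w ^+ (2 * (2 * m))) <= D -> 'Ex (fun w => g w ^+ (2 * (2 * m))) <= D ->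
  'Ex (fun w => (f w * g w) ^+ (2 * m)) <= D.
Proof.
move=> hf hg fD gD.
have hf2 := finite_momentsX (2 * (2 * m)) hf; have hg2 := finite_momentsX (2 * (2 * m)) hg.
apply: (@le_trans _ _ ('Ex (fun w => 2^-1 * (f w ^+ (2 * (2 * m)) + g w ^+ (2 * (2 * m)))))).
  apply: expect_le.
  - by apply: finite_momentsX; exact: finite_momentsM.
  - by apply: finite_momentsZ; exact: finite_momentsD.
  move=> w; rewrite exprMn (mulnC 2 (2 * m)%N) !(exprM _ (2 * m) 2).
  set u : R := f w ^+ (2 * m); set v : R := g w ^+ (2 * m).
  by have := sqr_ge0 (u - v); lra.
rewrite expectZ; last exact: finite_momentsD.
by rewrite expectD//; lra.
Qed.

Lemma average_moment (T : nat) (f : 'I_T -> Omega -> R) m D : (0 < T)%N -> (0 < m)%N ->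
  (forall t, finite_moments (f t)) ->
  (forall t, 'Ex (fun w => f t w ^+ (2 * m)) <= D) ->
  'Ex (fun w => (T%:R^-1 * \sum_t f t w) ^+ (2 * m)) <= D.
Proof.
move=> T0 m0 hf fD; have T0' : (0 : R) < T%:R by rewrite ltr0n.
have hfm t : finite_moments (fun w => f t w ^+ (2 * m)) by exact: finite_momentsX.
apply: (@le_trans _ _ ('Ex (fun w => T%:R^-1 * \sum_t f t w ^+ (2 * m)))).
  apply: expect_le.
  - by apply: finite_momentsX; apply: finite_momentsZ; exact: finite_moments_sum.
  - by apply: finite_momentsZ; exact: finite_moments_sum.
  move=> w; have mE : (2 * m = (2 * m).-1.+1)%N by rewrite prednK// muln_gt0.
  rewrite exprMn.
  apply: (@le_trans _ _ (T%:R^-1 ^+ (2 * m) * (\sum_t `|f t w|) ^+ (2 * m))).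
    rewrite ler_wpM2l ?exprn_ge0 ?invr_ge0//.
    rewrite !exprM -(real_normK (num_real (\sum_t f t w))).
    rewrite -!exprM lerXn2r ?nnegrE// ?sumr_ge0// ler_norm_sum//.
  have -> : \sum_t f t w ^+ (2 * m) = \sum_t `|f t w| ^+ (2 * m).
    by apply: eq_bigr => t _; rewrite !exprM real_normK ?num_real.
  have := @power_meanT R _ (fun t => `|f t w|) (2 * m).-1 (fun t => normr_ge0 _).
  rewrite -mE card_ord exprVn => h; rewrite ler_pdivrMl ?exprn_gt0//.
  have -> : T%:R ^+ (2 * m) = T%:R ^+ (2 * m).-1 * T%:R :> R by rewrite -exprSr -mE.
  by rewrite mulrA mulfK ?gt_eqF.
rewrite expectZ ?expect_sum//; last exact: finite_moments_sum.
rewrite ler_pdivrMl//; apply: (@le_trans _ _ (\sum_(t < T) D)); first exact: ler_sum.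
by rewrite sumr_const card_ord -[D *+ _]mulr_natl.
Qed.

(** Jensen's inequality bounds the power of the mean by the moment. *)
Lemma centered_moment f m D : (0 < m)%N -> finite_moments f ->
  'Ex (fun w => f w ^+ (2 * m)) <= D ->
  'Ex (fun w => (f w - 'Ex f) ^+ (2 * m)) <= 2 ^+ (2 * m) * (2 * D).
Proof.
move=> m0 hf fD; have hfm := finite_momentsX (2 * m) hf.
have mE : (2 * m = (2 * m).-1.+1)%N by rewrite prednK// muln_gt0.
set c := 'Ex f; set q := (2 * m)%N in mE *.
have hn := finite_moments_norm hf.
have absq (y : R) : y ^+ q = `|y| ^+ q by rewrite /q !exprM real_normK ?num_real.
(* Tangent at the mean of the absolute value. *)
have jensen : `|c| ^+ q <= D.
  pose a : R := 'Ex (fun w => `|f w|).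
  have ca : `|c| <= a by apply: le_normr_Rintegral => //; exact: finite_moments_integrable.
  have a0 : 0 <= a by exact: le_trans ca.
  apply: (@le_trans _ _ (a ^+ q)); first by rewrite lerXn2r ?nnegrE.
  apply: le_trans fD.
  have -> : a ^+ q = 'Ex (fun w => a ^+ q + q%:R * a ^+ q.-1 * (`|f w| - a)).
    rewrite expectD; last 2 first.
    - exact: finite_moments_cst.
    - apply: finite_momentsZ; apply: finite_momentsD => //; exact: finite_moments_cst.
    rewrite expect_cst expectZ; last first.
      by apply: finite_momentsD => //; exact: finite_moments_cst.
    rewrite (expectD hn (finite_moments_cst (- a))) -/a expect_cst.
    by rewrite subrr mulr0 addr0.
  apply: expect_le => //.
    apply: finite_momentsD; first exact: finite_moments_cst.
    apply: finite_momentsZ; apply: finite_momentsD => //; exact: finite_moments_cst.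
  by move=> w; rewrite (absq (f w)) mE; exact: bernoulli_tangent.
apply: (@le_trans _ _ ('Ex (fun w => 2 ^+ q * (f w ^+ q + `|c| ^+ q)))).
  apply: expect_le.
  - apply: finite_momentsX; apply: finite_momentsD => //; exact: finite_moments_cst.
  - apply: finite_momentsZ; apply: finite_momentsD => //; exact: finite_moments_cst.
  move=> w; rewrite (absq (_ - _)) (absq (f w)).
  have := @addr_pow_split R q 1 `|f w| `|c| ltr01 (normr_ge0 _) (normr_ge0 _).
  rewrite invr1 -mulrDr; apply: le_trans.
  by rewrite lerXn2r ?nnegrE ?addr_ge0// ler_normB.
rewrite expectZ; last by apply: finite_momentsD => //; exact: finite_moments_cst.
rewrite expectD//; last exact: finite_moments_cst.
by rewrite expect_cst ler_wpM2l ?exprn_ge0//; lra.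
Qed.

(** In terms of indicators: 1 is at most the indicator of [A] plus the sum of those of
    the bad events, and it suffices to take expectations. *)
Lemma union_bound (I : finType) (B : I -> set Omega) (A : set Omega) :
  (forall i, measurable (B i)) -> measurable A ->
  (forall w, (forall i, ~ B i w) -> A w) -> 1 - \sum_i Pr (B i) <= Pr A.
Proof.
move=> mB mA h.
have hB i := finite_moments_indic (mB i); have hA := finite_moments_indic mA.
have hS : finite_moments (fun w => \sum_i \1_(B i) w) by exact: finite_moments_sum.
have : 'Ex (fun=> 1) <= 'Ex (fun w => \1_A w + \sum_i \1_(B i) w).
  apply: expect_le; [exact: finite_moments_cst|exact: finite_momentsD|move=> w].
  have S0 : 0 <= \sum_i \1_(B i) w :> R by apply: sumr_ge0 => i _; rewrite indicE.
  have [wA|wA] := pselect (A w); first by rewrite indicE mem_set// lerDl.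
  have [i wB] : exists i, B i w by apply: contrapT => /forallNP /h.
  rewrite (bigD1 i)//= [\1_(B i) w]indicE mem_set// addrCA lerDl addr_ge0//.
  by apply: sumr_ge0 => j _; rewrite indicE.
rewrite expect_cst expectD// expect_sum// expect_indic//.
by under eq_bigr do rewrite expect_indic//; lra.
Qed.

(** * Tail bounds for the panel *)

(** Tail bounds are stated with the same constants for all sums of the panel:
    [moment_bound C K m] bounds the 2m-th moments of the errors, of the products of a
    covariate with an error, and of the centred averages of products of
    covariates.  The factor 2 and the number 8 below absorb the centring. *)
Definition tail_cst (K : R) : R := 2 * subgaussian_cst K.

Definition moment_growth (C : R) : R := 1 + 8 / C.

Definition tail_scale (C : R) : R := sum_moment_cst * moment_growth C ^+ 2.

Definition moment_bound (C K : R) (m : nat) : R :=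
  (moment_growth C ^+ 2 * m%:R ^+ 2) ^+ m * tail_cst K.

(** The order in which the terms of a double sum over the panel are revealed: unit
    after unit, and in chronological order within a unit. *)
Definition panel_rank (N T : nat) (it : 'I_N * 'I_T) : nat := (it.1 * T + it.2)%N.

Section Panel.
Context (N T p : nat).
Context (x : 'I_N -> 'I_T -> 'I_p -> {RV P >-> R}) (eps : 'I_N -> 'I_T -> {RV P >-> R}).
Variables C K : R.
Hypothesis C0 : 0 < C.
Hypothesis K0 : 0 < K.
Hypothesis N0 : (0 < N)%N.
Hypothesis T0 : (0 < T)%N.
Hypothesis hA1 : assumption_A1 x eps.
Hypothesis hA2 : assumption_A2b x eps C K.

Let W i w := (unit_covariates x i w, unit_errors eps i w).
Let xh (k : 'I_p) (t : 'I_T) (u : T.-tuple (p.-tuple R)) : R := tnth (tnth u t) k.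
Let eh (t : 'I_T) (v : T.-tuple R) : R := tnth v t.

Let xE i t k w : x i t k w = xh k t (unit_covariates x i w).
Proof. by rewrite /xh !tnth_mktuple. Qed.

Let eE i t w : eps i t w = eh t (unit_errors eps i w).
Proof. by rewrite /eh tnth_mktuple. Qed.

Let mxh k t : measurable_fun setT (xh k t).
Proof. exact: (measurableT_comp (measurable_tnth k) (measurable_tnth t)). Qed.

Let meh t : measurable_fun setT (eh t).
Proof. exact: measurable_tnth. Qed.

Let mU i : measurable_fun setT (unit_covariates x i).
Proof.
apply/measurable_fun_tnthP => t; apply/measurable_fun_tnthP => k.
rewrite (_ : _ \o _ = x i t k); first exact: measurable_funPT.
by apply/funext => w /=; rewrite xE.
Qed.

Let mV i : measurable_fun setT (unit_errors eps i).
Proof.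
apply/measurable_fun_tnthP => t.
rewrite (_ : _ \o _ = eps i t); first exact: measurable_funPT.
by apply/funext => w /=; rewrite eE.
Qed.

Let mW i : measurable_fun setT (W i).
Proof. exact: measurable_fun_pair. Qed.

Let same_tail (h : T.-tuple (p.-tuple R) * T.-tuple R -> R) i j (u : R) :
  measurable_fun setT h ->
  P [set w | (u <= `|h (W i w)|)%R] = P [set w | (u <= `|h (W j w)|)%R].
Proof.
move=> mh; have [_ id_ _ _] := hA1.
have mB : measurable [set z | u <= `|h z|].
  have mh' : measurable_fun setT (fun z => `|h z|) by exact: measurableT_comp.
  rewrite (_ : [set z | _] = (fun z => `|h z|) @^-1` `[u, +oo[%classic).
    by rewrite -[X in measurable X]setTI; exact: mh' (measurable_itv _).
  by apply/seteqP; split=> w /=; rewrite in_itv /= andbT.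
exact: (id_ i j _ mB).
Qed.

Let i0 := Ordinal N0.

Let mx1 k t : measurable_fun setT (fun z : T.-tuple (p.-tuple R) * T.-tuple R => xh k t z.1).
Proof. exact: (measurableT_comp (mxh k t) measurable_fst). Qed.

Let me2 t : measurable_fun setT (fun z : T.-tuple (p.-tuple R) * T.-tuple R => eh t z.2).
Proof. exact: (measurableT_comp (meh t) measurable_snd). Qed.

Lemma covariate_tail i t k (u : R) : 0 < u ->
  (P [set w | (u <= `|x i t k w|)%R] <= (K / 2 * expR (- (C * u ^+ 2)))%:E)%E.
Proof.
move=> u0; have [h _] := hA2 (erefl : i0 = 0%N :> nat) u0 t; move/(_ k) in h.
move: h; rewrite (_ : [set w | _] = [set w | (u <= `|xh k t (W i0 w).1|)%R]); last first.
  by apply/seteqP; split=> w /=; rewrite xE.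
rewrite (_ : [set w | (u <= `|x i t k w|)%R] = [set w | (u <= `|xh k t (W i w).1|)%R]).
  by rewrite (same_tail i i0 u (mx1 k t)).
by apply/seteqP; split=> w /=; rewrite xE.
Qed.

Lemma error_tail i t (u : R) : 0 < u ->
  (P [set w | (u <= `|eps i t w|)%R] <= (K / 2 * expR (- (C * u ^+ 2)))%:E)%E.
Proof.
move=> u0; have [_ h] := hA2 (erefl : i0 = 0%N :> nat) u0 t.
move: h; rewrite (_ : [set w | _] = [set w | (u <= `|eh t (W i0 w).2|)%R]); last first.
  by apply/seteqP; split=> w /=; rewrite eE.
rewrite (_ : [set w | (u <= `|eps i t w|)%R] = [set w | (u <= `|eh t (W i w).2|)%R]).
  by rewrite (same_tail i i0 u (me2 t)).
by apply/seteqP; split=> w /=; rewrite eE.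
Qed.

Let Kc1 : 1 <= subgaussian_cst K. Proof. exact: subgaussian_cst_ge1. Qed.

Lemma covariate_finite_moments i t k : finite_moments (x i t k).
Proof.
by apply: (@subgaussian_finite_moments _ C K) => // u; exact: covariate_tail.
Qed.

Lemma error_finite_moments i t : finite_moments (eps i t).
Proof.
by apply: (@subgaussian_finite_moments _ C K) => // u; exact: error_tail.
Qed.

Lemma covariate_moment i t k m : (0 < m)%N ->
  'Ex (fun w => x i t k w ^+ (2 * m)) <= (2 * m%:R / C) ^+ m * subgaussian_cst K.
Proof.
move=> m0; have [||_ ] // := @subgaussian_integrable (x i t k) C K _ C0 K0 _ m m0.
by move=> u; exact: covariate_tail.
Qed.

Lemma error_moment i t m : (0 < m)%N ->
  'Ex (fun w => eps i t w ^+ (2 * m)) <= (2 * m%:R / C) ^+ m * subgaussian_cst K.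
Proof.
move=> m0; have [||_ ] // := @subgaussian_integrable (eps i t) C K _ C0 K0 _ m m0.
by move=> u; exact: error_tail.
Qed.

Let indepW : mutually_independent P W. Proof. by case: hA1. Qed.

Let rk := @panel_rank N T.

Let rk_lt (j i : 'I_N) (s t : 'I_T) :
  (rk (j, s) < rk (i, t))%N = (j < i)%N || (j == i) && (s < t)%N.
Proof.
rewrite /rk /panel_rank /=; case: (ltngtP j i) => [ji|ij|/val_inj ->] /=.
- rewrite (@leq_trans (i * T))//; last exact: leq_addr.
  by rewrite (@leq_trans (j.+1 * T))// ?leq_mul2r ?ji ?orbT// mulSn addnC ltn_add2r.
- rewrite (_ : j == i = false); last by apply/negbTE; rewrite -val_eqE /= gtn_eqF.
  apply/negbTE; rewrite -leqNgt (@leq_trans (j * T))//; last exact: leq_addr.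
  rewrite (@leq_trans (i.+1 * T))// ?leq_mul2r ?ij ?orbT// mulSn addnC leq_add2r.
  exact: ltnW.
- by rewrite eqxx ltn_add2l.
Qed.

Let rk_inj : injective rk.
Proof.
move=> [i t] [j s] h.
have h1 : (rk (i, t) < rk (j, s))%N = false by rewrite h ltnn.
have h2 : (rk (j, s) < rk (i, t))%N = false by rewrite h ltnn.
move: h1 h2; rewrite !rk_lt [i == j]eq_sym.
case: (eqVneq j i) => [->|ji] /=.
  rewrite ltnn /= => ts st; congr pair; apply/val_inj/eqP; rewrite eqn_leq.
  by rewrite (leqNgt t) (leqNgt s) st ts.
rewrite !orbF => h1 h2; move: ji; rewrite -val_eqE /= eqn_leq (leqNgt j) (leqNgt i).
by rewrite h1 h2.
Qed.

Let rk_bound it : (rk it < N * T)%N.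
Proof.
case: it => i t; rewrite /rk /panel_rank /=.
rewrite (@leq_trans (i.+1 * T))//; last by rewrite leq_mul2r ltn_ord orbT.
by rewrite mulSn addnC ltn_add2r.
Qed.

Let past_split (F : 'I_N -> 'I_T -> R) (i : 'I_N) (t : 'I_T) :
  \sum_(js | (rk js < rk (i, t))%N) F js.1 js.2 =
  \sum_(j in [set j : 'I_N | (j < i)%N]%SET) (\sum_s F j s) +
  \sum_(s in [set s : 'I_T | (s < t)%N]%SET) F i s.
Proof.
rewrite (eq_bigl (fun js : 'I_N * 'I_T => predT js.1 &&
    ((js.1 < i)%N || (js.1 == i) && (js.2 < t)%N))); last by move=> [j s]; rewrite rk_lt.
rewrite -(pair_big_dep predT (fun (j : 'I_N) (s : 'I_T) => (j < i)%N || (j == i) && (s < t)%N) F) /=.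
rewrite (bigID (fun j : 'I_N => (j < i)%N)) /=; congr (_ + _).
  apply: eq_big => [j|j ji]; first by rewrite inE.
  by apply: eq_bigl => s; rewrite ji.
rewrite (bigD1 i) ?ltnn//= [X in _ + X]big1 ?addr0.
  by apply: eq_bigl => s; rewrite inE eqxx.
move=> j /andP[ji jni]; rewrite big_pred0// => s.
by rewrite (negbTE ji) (negbTE jni).
Qed.

(** The past splits into the earlier units and the earlier periods of the same
    unit; the two are separated by the binomial theorem. *)
Lemma score_orth (k : 'I_p) (it : 'I_N * 'I_T) l :
  'Ex (fun w => (\sum_(js | (panel_rank js < panel_rank it)%N) x js.1 js.2 k w * eps js.1 js.2 w) ^+ l *
      (x it.1 it.2 k w * eps it.1 it.2 w)) = 0.
Proof.
case: it => i t /=.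
have hxe j s : finite_moments (fun w => x j s k w * eps j s w).
  by apply: finite_momentsM; [exact: covariate_finite_moments|exact: error_finite_moments].
under [X in Rintegral _ _ X]funext => w do
  rewrite (past_split (fun j s => x j s k w * eps j s w)).
apply: binomial_orth; [| |exact: hxe|].
- by apply: finite_moments_sum => j; exact: finite_moments_sum.
- exact: finite_moments_sum.
move=> a b.
pose y (j : 'I_N) (z : T.-tuple (p.-tuple R) * T.-tuple R) :=
  \sum_s xh k s z.1 * eh s z.2.
pose g (z : T.-tuple (p.-tuple R) * T.-tuple R) :=
  (\sum_(s in [set s : 'I_T | (s < t)%N]%SET) xh k s z.1 * eh s z.2) ^+ b *
    (xh k t z.1 * eh t z.2).
have my j : measurable_fun setT (y j).
  by apply: measurable_sum => s; exact: measurable_funM.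
have mg : measurable_fun setT g.
  apply: measurable_funM; last exact: measurable_funM.
  by apply: measurable_funX; apply: measurable_sum_cond => s _; exact: measurable_funM.
have yE j w : y j (W j w) = \sum_s x j s k w * eps j s w.
  by apply: eq_bigr => s _; rewrite xE eE.
have gE w : g (W i w) =
    (\sum_(s in [set s : 'I_T | (s < t)%N]%SET) x i s k w * eps i s w) ^+ b *
    (x i t k w * eps i t w).
  rewrite /g xE eE; congr (_ ^+ _ * _); apply: eq_bigr => s _; by rewrite xE eE.
have hy j : finite_moments (y j \o W j).
  rewrite (_ : _ \o _ = fun w => \sum_s x j s k w * eps j s w).
    exact: finite_moments_sum.
  by apply/funext => w; exact: yE.
have hg : finite_moments (g \o W i).
  rewrite (_ : _ \o _ = fun w => (\sum_(s in [set s : 'I_T | (s < t)%N]%SET)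
      x i s k w * eps i s w) ^+ b * (x i t k w * eps i t w)).
    by apply: finite_momentsM => //; apply: finite_momentsX; exact: finite_moments_sum.
  by apply/funext => w; exact: gE.
have h0 : 'Ex (g \o W i) = 0.
  have [_ _ /(_ i) ind /(_ i) mds] := hA1.
  have := @unit_sum_orth _ _ _ _ T (unit_covariates x i) (unit_errors eps i)
    (xh k) eh (fun t => eps i t) (mU i) (mV i) (mxh k) meh _ _ (eE i) ind mds t
    [set s : 'I_T | (s < t)%N]%SET b (xh k t) (cst 1).
  rewrite (_ : (fun w => _ * (_ * (_ * _))) = g \o W i); last first.
    apply/funext => w; rewrite /= gE mul1r -xE; congr (_ ^+ _ * _).
    by apply: eq_bigr => s _; rewrite xE.
  have hxk s : finite_moments (xh k s \o unit_covariates x i).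
    rewrite (_ : _ \o _ = x i s k); first exact: covariate_finite_moments.
    by apply/funext => w; rewrite /= xE.
  apply => //.
  - by move=> s; exact: error_finite_moments.
  - by move=> s; rewrite inE.
  - exact: finite_moments_cst.
  - exact: measurable_cst.
have iJ : i \notin [set j : 'I_N | (j < i)%N]%SET by rewrite inE ltnn.
rewrite -[RHS](indep_sum_orth mW my hy indepW a iJ mg hg h0).
congr Rintegral; apply/funext => w; rewrite gE; congr (_ ^+ _ * _).
by apply: eq_bigr => j _; rewrite yE.
Qed.

Lemma error_orth i (t : 'I_T) l :
  'Ex (fun w => (\sum_(s : 'I_T | (s < t)%N) eps i s w) ^+ l * eps i t w) = 0.
Proof.
have [_ _ _ /(_ i) mds] := hA1.
have he s : finite_moments (eps i s) by exact: error_finite_moments.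
apply: (@martingale_orth T (fun t => eps i t) he mds t
  (fun w => (\sum_(s : 'I_T | (s < t)%N) eps i s w) ^+ l)).
  apply: measurable_funX; apply: measurable_sum_cond => s st.
  move=> _ B mB; rewrite setTI; apply: sub_sigma_algebra.
  by exists s => //; exists B => //; rewrite setTI.
by apply: finite_momentsX; exact: finite_moments_sum.
Qed.

Definition unit_gram (j k : 'I_p) i w := T%:R^-1 * \sum_t x i t j w * x i t k w.

Let hV j k i : finite_moments (unit_gram j k i).
Proof.
apply: finite_momentsZ; apply: finite_moments_sum => t.
by apply: finite_momentsM; exact: covariate_finite_moments.
Qed.

Lemma gram_orth (j k : 'I_p) (i : 'I_N) l :
  'Ex (fun w => (\sum_(i' : 'I_N | (i' < i)%N) (unit_gram j k i' w - 'Ex (unit_gram j k i'))) ^+ l *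
      (unit_gram j k i w - 'Ex (unit_gram j k i))) = 0.
Proof.
pose v (z : T.-tuple (p.-tuple R) * T.-tuple R) := T%:R^-1 * \sum_t xh j t z.1 * xh k t z.1.
pose y (i' : 'I_N) z := v z - 'Ex (unit_gram j k i').
have mv : measurable_fun setT v.
  apply: measurable_funM => //; apply: measurable_sum => s.
  by apply: measurable_funM; exact: mx1.
have my i' : measurable_fun setT (y i') by exact: measurable_funB.
have vE i' w : v (W i' w) = unit_gram j k i' w.
  by rewrite /v /unit_gram; congr (_ * _); apply: eq_bigr => t _; rewrite !xE.
have yE i' : y i' \o W i' = fun w => unit_gram j k i' w - 'Ex (unit_gram j k i').
  by apply/funext => w; rewrite /= /y vE.
have hVc i' : finite_moments (fun w => unit_gram j k i' w - 'Ex (unit_gram j k i')).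
  by apply: finite_momentsD => //; exact: finite_moments_cst.
have hy i' : finite_moments (y i' \o W i') by rewrite yE.
have h0 : 'Ex (y i \o W i) = 0.
  rewrite yE (expectD (hV j k i) (finite_moments_cst (- 'Ex (unit_gram j k i)))).
  by rewrite expect_cst subrr.
have iJ : i \notin [set j : 'I_N | (j < i)%N]%SET by rewrite inE ltnn.
rewrite -[RHS](indep_sum_orth mW my hy indepW l iJ (my i) (hy i) h0).
congr Rintegral; apply/funext => w; rewrite /y !vE; congr (_ ^+ _ * _).
by apply: eq_big => [i'|i' _]; rewrite ?inE ?vE.
Qed.

Let C' : 0 <= C^-1. Proof. by rewrite invr_ge0 ltW. Qed.

Let L1 : 1 <= moment_growth C. Proof. by rewrite /moment_growth lerDl divr_ge0// ltW. Qed.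

Let k01 : 1 <= tail_cst K. Proof. by rewrite /tail_cst; move: Kc1; lra. Qed.

Let mom_bound_small m : (0 < m)%N ->
  (2 * m%:R / C) ^+ m * subgaussian_cst K <= moment_bound C K m.
Proof.
move=> m0; have m1 : (1 : R) <= m%:R by rewrite ler1n.
have Kp : 0 <= subgaussian_cst K by exact: le_trans Kc1.
rewrite /moment_bound /tail_cst; apply: ler_pM => //.
- by rewrite exprn_ge0// mulr_ge0// mulr_ge0//; apply: le_trans m1.
- rewrite lerXn2r ?nnegrE//.
  + by rewrite mulr_ge0// mulr_ge0//; apply: le_trans m1.
  + by rewrite mulr_ge0 ?sqr_ge0.
  + have h : 2 * m%:R / C <= moment_growth C * m%:R.
      rewrite mulrAC ler_wpM2r ?(le_trans ler01 m1)// /moment_growth mulrC [8 / C]mulrC.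
      by move: C'; lra.
    apply: (le_trans h); rewrite -exprMn; have Lm : 1 <= moment_growth C * m%:R by rewrite mulr_ege1.
    by rewrite expr2 ler_peMl// (le_trans ler01).
- lra.
Qed.

Let mom_bound_prod m : (0 < m)%N ->
  2 ^+ (2 * m) * (2 * ((2 * (2 * m)%:R / C) ^+ (2 * m) * subgaussian_cst K)) <= moment_bound C K m.
Proof.
move=> m0; have m1 : (1 : R) <= m%:R by rewrite ler1n.
have Kp : 0 <= subgaussian_cst K by exact: le_trans Kc1.
rewrite /moment_bound /tail_cst.
rewrite [leLHS](_ : _ = (2 * (2 * (2 * m)%:R / C)) ^+ (2 * m) * (2 * subgaussian_cst K)); last first.
  by rewrite [(2 * (_ / C)) ^+ _]exprMn; ring.
have -> : (moment_growth C ^+ 2 * m%:R ^+ 2) ^+ m = (moment_growth C * m%:R) ^+ (2 * m).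
  by rewrite exprM [(moment_growth C * _) ^+ 2]exprMn.
apply: ler_wpM2r; first exact: mulr_ge0.
rewrite lerXn2r ?nnegrE//.
- by rewrite !mulr_ge0.
- by rewrite mulr_ge0 ?(le_trans ler01 m1)// (le_trans ler01 L1).
- rewrite natrM (_ : 2 * (2 * (2 * m%:R) / C) = 8 / C * m%:R); last by field; rewrite gt_eqF.
  by rewrite ler_wpM2r ?(le_trans ler01 m1)// lerDr.
Qed.

Let mom_prod_moment m D : (0 < m)%N ->
  D <= (2 * (2 * m)%:R / C) ^+ (2 * m) * subgaussian_cst K -> D <= moment_bound C K m.
Proof.
move=> m0 h; apply: le_trans (mom_bound_prod m0); apply: (le_trans h).
have Kp : 0 <= subgaussian_cst K by exact: le_trans Kc1.
set z := _ * subgaussian_cst K; have z0 : 0 <= z.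
  by rewrite mulr_ge0 ?exprn_ge0// ?mulr_ge0.
have h1 : 1 <= 2 ^+ (2 * m) :> R by rewrite exprn_ege1// ler1n.
by rewrite mulrA ler_peMl// mulr_ege1// ler1n.
Qed.

(** Combining the moment bound for the sum with that for its terms gives
    E S^(2m) <= (tail_scale C * m^3 * n)^m * tail_cst K, to which [moment_tail]
    applies. *)
Lemma martingale_sum_tail (I : finType) (r : I -> nat) (X : I -> Omega -> R) (n : nat) (v th : R) :
  injective r -> (forall i, (r i < n)%N) -> (0 < n)%N ->
  (forall i, finite_moments (X i)) ->
  (forall i l, 'Ex (fun w => (\sum_(j | (r j < r i)%N) X j w) ^+ l.+1 * X i w) = 0) ->
  (forall i m, (0 < m)%N -> 'Ex (fun w => X i w ^+ (2 * m)) <= moment_bound C K m) ->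
  0 < v -> 0 <= th -> expR 1 * tail_scale C * th ^+ 3 <= v ->
  Pr [set w | n%:R * v < (\sum_i X i w) ^+ 2] <= tail_cst K * expR 1 * expR (- th).
Proof.
move=> rinj rn n0 hX orth mom v0 th0 hv.
apply: (@moment_tail _ (tail_scale C) n%:R (tail_cst K) v th) => //.
- exact: finite_moments_sum.
- rewrite /tail_scale mulr_gt0 ?exprn_gt0 ?(lt_le_trans ltr01 L1)//.
  exact: lt_le_trans ltr01 sum_moment_cst_ge1.
- by rewrite ltr0n.
move=> m m0; apply: (le_trans (even_moment_sum rinj rn m0 _ hX _ (fun i => mom i m m0))).
- by apply: mulr_ge0; [rewrite exprn_ge0// mulr_ge0 ?sqr_ge0|exact: le_trans k01].
- move=> i; have -> : ((2 * m).-1 = (2 * m).-2.+1)%N by case: m m0 => // m _; rewrite mulnS.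
  exact: orth.
rewrite /moment_bound mulrA -exprMn ler_wpM2r ?(le_trans ler01 k01)//.
rewrite le_eqVlt; apply/orP; left; apply/eqP; congr (_ ^+ _).
by rewrite /tail_scale /moment_growth; ring.
Qed.

Lemma score_tail k (v th : R) : 0 < v -> 0 <= th -> expR 1 * tail_scale C * th ^+ 3 <= v ->
  Pr [set w | (N * T)%:R * v < (\sum_i \sum_t x i t k w * eps i t w) ^+ 2] <=
  tail_cst K * expR 1 * expR (- th).
Proof.
move=> v0 th0 hv.
have := @martingale_sum_tail ('I_N * 'I_T)%type rk (fun it w => x it.1 it.2 k w * eps it.1 it.2 w)
   (N * T)%N v th rk_inj rk_bound _ _ (fun it l => score_orth k it l.+1) _ v0 th0 hv.
under eq_set do rewrite -(pair_bigA _ (fun i t => x i t k _ * eps i t _)) /=.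
apply.
- by rewrite muln_gt0 N0.
- by move=> it; apply: finite_momentsM; [exact: covariate_finite_moments|exact: error_finite_moments].
move=> [i t] m m0 /=; apply: mom_prod_moment => //.
apply: product_moment; [exact: covariate_finite_moments|exact: error_finite_moments| |].
- by apply: covariate_moment; rewrite muln_gt0.
- by apply: error_moment; rewrite muln_gt0.
Qed.

Lemma error_sum_tail i (v th : R) : 0 < v -> 0 <= th -> expR 1 * tail_scale C * th ^+ 3 <= v ->
  Pr [set w | T%:R * v < (\sum_t eps i t w) ^+ 2] <= tail_cst K * expR 1 * expR (- th).
Proof.
move=> v0 th0 hv.
apply: (@martingale_sum_tail 'I_T val (fun t w => eps i t w) T v th val_inj _ T0 _ _ _ v0 th0 hv).
- by move=> t; exact: ltn_ord.
- by move=> t; exact: error_finite_moments.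
- by move=> t l; exact: error_orth.
- move=> t m m0; apply: le_trans (mom_bound_small m0); exact: error_moment.
Qed.

Lemma gram_tail j k (v th : R) : 0 < v -> 0 <= th -> expR 1 * tail_scale C * th ^+ 3 <= v ->
  Pr [set w | N%:R * v < (\sum_i (unit_gram j k i w - 'Ex (unit_gram j k i))) ^+ 2] <=
  tail_cst K * expR 1 * expR (- th).
Proof.
move=> v0 th0 hv.
apply: (@martingale_sum_tail 'I_N val (fun i w => unit_gram j k i w - 'Ex (unit_gram j k i)) N v th val_inj _ N0 _ _ _ v0 th0 hv).
- by move=> t; exact: ltn_ord.
- by move=> i; apply: finite_momentsD => //; exact: finite_moments_cst.
- by move=> i l; exact: gram_orth.
- move=> i m m0; apply: le_trans (mom_bound_prod m0); apply: centered_moment => //.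
  apply: average_moment => // t.
    by apply: finite_momentsM; exact: covariate_finite_moments.
  apply: product_moment; try exact: covariate_finite_moments.
  + by apply: covariate_moment; rewrite muln_gt0.
  + by apply: covariate_moment; rewrite muln_gt0.
Qed.

(** A sum with a single term: the empty past makes the orthogonality trivial. *)
Lemma covariate_mean_tail i k (v th : R) : 0 < v -> 0 <= th -> expR 1 * tail_scale C * th ^+ 3 <= v ->
  Pr [set w | v < (T%:R^-1 * \sum_t x i t k w) ^+ 2] <= tail_cst K * expR 1 * expR (- th).
Proof.
move=> v0 th0 hv.
have := @martingale_sum_tail 'I_1 val (fun _ w => T%:R^-1 * \sum_t x i t k w) 1 v th val_inj
  (@ltn_ord 1) isT _ _ _ v0 th0 hv.
rewrite mul1r; under eq_set do rewrite big_ord1; apply.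
- by move=> _; apply: finite_momentsZ; apply: finite_moments_sum => t; exact: covariate_finite_moments.
- move=> o l; rewrite -[RHS](expect_cst 0); congr Rintegral; apply/funext => w.
  by rewrite (ord1 o) big_pred0// expr0n mul0r.
- move=> _ m m0; apply: le_trans (mom_bound_small m0); apply: average_moment => // t.
    exact: covariate_finite_moments.
  exact: covariate_moment.
Qed.

Lemma Gamma_ulE j k :
  fine 'E_P[fun w => ((covariate_mx (x_at x w))^T *m covariate_mx (x_at x w)) j k /
     (N%:R * T%:R)] = N%:R^-1 * \sum_i 'Ex (unit_gram j k i).
Proof.
rewrite expectation.unlock.
transitivity ('Ex (fun w => N%:R^-1 * \sum_i unit_gram j k i w)).
  congr Rintegral; apply/funext => w; rewrite gram_covariateE /unit_gram.
  rewrite -mulr_sumr mulrA -invfM mulrC; congr (_ * _).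
by rewrite expectZ ?expect_sum//; exact: finite_moments_sum.
Qed.

(** Diagonal blocks: the covariate block is a centred average over units, and the
    other one is the identity in both matrices.  The off-diagonal blocks vanish in
    the population, and their entries are the averages of covariates
    divided by the square root of N. *)
Lemma Gamma_Psi_close w tau : 0 <= tau ->
  (forall j k, (\sum_i (unit_gram j k i w - 'Ex (unit_gram j k i))) ^+ 2 <= N%:R * (N%:R * tau ^+ 2)) ->
  (forall i k, (T%:R^-1 * \sum_t x i t k w) ^+ 2 <= N%:R * tau ^+ 2) ->
  forall a b, `|Psi_mx (x_at x w) a b - Gamma_mx x a b| <= tau.
Proof.
move=> tau0 hG hM.
have Np : (0 : R) < N%:R by rewrite ltr0n.
have Tp : (0 : R) < T%:R by rewrite ltr0n.
have hO k i : `|(\sum_t x_at x w i t k) / (Num.sqrt N%:R * T%:R)| <= tau.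
  rewrite -(@ler_pXn2r _ 2)// ?nnegrE ?normr_ge0// real_normK ?num_real//.
  have := hM i k; rewrite -ler_pdivrMl//; apply: le_trans.
  rewrite le_eqVlt; apply/orP; left; apply/eqP.
  by rewrite !exprMn exprVn exprMn sqr_sqrtr// [in RHS]exprVn; field; rewrite !gt_eqF.
move=> a b; rewrite Psi_mxE// /Gamma_mx.
case: (split_ordP a) => i ->; case: (split_ordP b) => j ->.
- rewrite !block_mxEul !mxE Gamma_ulE.
  have -> : (\sum_i0 \sum_t x_at x w i0 t i * x_at x w i0 t j) / (N%:R * T%:R) =
      N%:R^-1 * \sum_i0 unit_gram i j i0 w.
    rewrite /unit_gram -mulr_sumr mulrA -invfM mulrC; congr (_ * _).
  rewrite -mulrBr -sumrB normrM ger0_norm ?invr_ge0// ler_pdivrMl//.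
  rewrite -(@ler_pXn2r _ 2)// ?nnegrE ?normr_ge0 ?mulr_ge0// real_normK ?num_real//.
  by apply: (le_trans (hG i j)); rewrite exprMn expr2 mulrA.
- by rewrite !block_mxEur mxE [X in _ - X]mxE subr0; exact: hO.
- by rewrite !block_mxEdl mxE [X in _ - X]mxE subr0; exact: hO.
- by rewrite !block_mxEdr subrr normr0.
Qed.

Lemma measurable_Psi_entry a b : measurable_fun setT (fun w => Psi_mx (x_at x w) a b).
Proof.
have mX i t k : measurable_fun setT (x i t k) by exact: measurable_funPT.
case: (split_ordP a) => i ->; case: (split_ordP b) => j ->.
- rewrite (_ : (fun w => _) = fun w =>
     (\sum_i0 \sum_t x i0 t i w * x i0 t j w) / (N%:R * T%:R)).
    apply: measurable_funM => //; apply: measurable_sum => i1; apply: measurable_sum => t.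
    exact: measurable_funM.
  by apply/funext => w; rewrite Psi_mxE// block_mxEul mxE.
- rewrite (_ : (fun w => _) = fun w => (\sum_t x j t i w) / (Num.sqrt N%:R * T%:R)).
    by apply: measurable_funM => //; exact: measurable_sum.
  by apply/funext => w; rewrite Psi_mxE// block_mxEur mxE.
- rewrite (_ : (fun w => _) = fun w => (\sum_t x i t j w) / (Num.sqrt N%:R * T%:R)).
    by apply: measurable_funM => //; exact: measurable_sum.
  by apply/funext => w; rewrite Psi_mxE// block_mxEdl mxE.
- rewrite (_ : (fun w => _) = cst (1%:M i j)); first exact: measurable_cst.
  by apply/funext => w; rewrite Psi_mxE// block_mxEdr.
Qed.

Let BX (v : R) k := [set w | (N * T)%:R * v < (\sum_i \sum_t x i t k w * eps i t w) ^+ 2].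
Let BD (v : R) i := [set w | T%:R * v < (\sum_t eps i t w) ^+ 2].
Let BG (v : R) jk := [set w | N%:R * v < (\sum_i (unit_gram jk.1 jk.2 i w - 'Ex (unit_gram jk.1 jk.2 i))) ^+ 2].
Let BM (v : R) ik := [set w | v < (T%:R^-1 * \sum_t x ik.1 t ik.2 w) ^+ 2].

Let event_AE (v1 v2 : R) : 0 <= v1 -> 0 <= v2 ->
  event_A x eps (Num.sqrt (4 * N%:R * T%:R * v1)) (Num.sqrt (4 * T%:R * v2)) =
  (\bigcap_k ~` BX v1 k) `&` (\bigcap_i ~` BD v2 i).
Proof.
move=> v10 v20.
have aux (v s : R) : 0 <= v -> (`|s| <= Num.sqrt (4 * v) / 2) <-> ~ (v < s ^+ 2).
  have s4 : Num.sqrt 4 = 2 :> R.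
    by rewrite (_ : 4 = 2 ^+ 2); [rewrite sqrtr_sqr ger0_norm|ring].
  move=> v0; rewrite sqrtrM// s4 mulrAC mulfV ?mul1r ?pnatr_eq0//.
  rewrite -(@ler_pXn2r _ 2)// ?nnegrE ?normr_ge0 ?sqrtr_ge0// real_normK ?num_real// sqr_sqrtr//.
  by rewrite leNgt; split=> [/negP//|/negP].
have e1 : 4 * N%:R * T%:R * v1 = 4 * ((N * T)%:R * v1) by rewrite natrM; ring.
have e2 : 4 * T%:R * v2 = 4 * (T%:R * v2) by ring.
have n1 : 0 <= (N * T)%:R * v1 by rewrite mulr_ge0.
have n2 : 0 <= T%:R * v2 by rewrite mulr_ge0.
apply/seteqP; split => w.
  move=> [h1 h2]; split=> [k|i] _.
    by have := mx_norm_entry k h1; rewrite covariate_errorE e1 => /(aux _ _ n1).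
  by have := mx_norm_entry i h2; rewrite dummy_errorE e2 => /(aux _ _ n2).
move=> [h1 h2]; split; apply: mx_norm_le; rewrite ?divr_ge0 ?sqrtr_ge0//.
  by move=> k; rewrite covariate_errorE e1; apply/(aux _ _ n1); exact: h1.
by move=> i; rewrite dummy_errorE e2; apply/(aux _ _ n2); exact: h2.
Qed.

(** Outside p + N + p^2 + N p bad events, each of which has a tail bound, the
    first event holds by definition and the second by perturbation. *)
Lemma event_probability (v1 v2 th1 th2 th3 tau rho : R) (r1 r2 : nat) :
  let lam := Num.sqrt (4 * N%:R * T%:R * v1) in
  let mu := Num.sqrt (4 * T%:R * v2) in
  let kap := kappa2 T lam mu (Gamma_mx x) r1 r2 in
  let A := tail_cst K * expR 1 in
  0 < v1 -> 0 < v2 -> 0 < tau -> 0 <= th1 -> 0 <= th2 -> 0 <= th3 ->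
  expR 1 * tail_scale C * th1 ^+ 3 <= v1 -> expR 1 * tail_scale C * th2 ^+ 3 <= v2 ->
  expR 1 * tail_scale C * th3 ^+ 3 <= N%:R * tau ^+ 2 ->
  v1 <= rho * v2 -> v2 <= rho * v1 ->
  0 < kap -> tau * (16 * rho * (r1 + r2)%:R) <= kap / 2 ->
  ((1 - A * (p%:R * expR (- th1)) - A * (N%:R * expR (- th2))
     - A * (p%:R ^+ 2 + N%:R * p%:R) * expR (- th3))%:E
   <= P (event_A x eps lam mu `&` event_B x lam mu r1 r2))%E.
Proof.
move=> lam mu kap A v10 v20 tau0 th10 th20 th30 h1 h2 h3 rho1 rho2 kap0 htau.
have Np : (0 : R) < N%:R by rewrite ltr0n.
have Tp : (0 : R) < T%:R by rewrite ltr0n.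
have v30 : 0 < N%:R * tau ^+ 2 by rewrite mulr_gt0// exprn_gt0.
have mX i t k : measurable_fun setT (x i t k) by exact: measurable_funPT.
have mE i t : measurable_fun setT (eps i t) by exact: measurable_funPT.
have mBX k : measurable (BX v1 k).
  apply: measurable_superlevel; apply: measurable_funX; apply: measurable_sum => i.
  by apply: measurable_sum => t; exact: measurable_funM.
have mBD i : measurable (BD v2 i).
  by apply: measurable_superlevel; apply: measurable_funX; exact: measurable_sum.
have mBG jk : measurable (BG (N%:R * tau ^+ 2) jk).
  apply: measurable_superlevel; apply: measurable_funX; apply: measurable_sum => i.
  by apply: measurable_funB => //; exact: finite_moments_measurable.
have mBM ik : measurable (BM (N%:R * tau ^+ 2) ik).
  apply: measurable_superlevel; apply: measurable_funX; apply: measurable_funM => //.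
  exact: measurable_sum.
have mA : measurable (event_A x eps lam mu).
  rewrite event_AE ?ltW//; apply: measurableI.
    apply: fin_bigcap_measurable; [exact: finite_finset|].
    by move=> k _; apply: measurableC; exact: mBX.
  apply: fin_bigcap_measurable; [exact: finite_finset|].
  by move=> i _; apply: measurableC; exact: mBD.
have mB : measurable (event_B x lam mu r1 r2).
  apply: (@measurable_kappa2_ge _ _ _ N T p lam mu (kap / 2) (Gamma_mx x)) => //.
    by rewrite divr_gt0.
  exact: measurable_Psi_entry.
have mAB := measurableI _ _ mA mB.
rewrite prE// lee_fin.
pose B (z : ('I_p + 'I_N) + ('I_p * 'I_p + 'I_N * 'I_p)) := match z with
  | inl (inl k) => BX v1 k | inl (inr i) => BD v2 i
  | inr (inl jk) => BG (N%:R * tau ^+ 2) jk | inr (inr ik) => BM (N%:R * tau ^+ 2) ik end.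
have mBz z : measurable (B z).
  by case: z => [[k|i]|[jk|ik]]; [exact: mBX|exact: mBD|exact: mBG|exact: mBM].
apply: le_trans (union_bound mBz mAB _); last first.
  move=> w hw; split.
    rewrite event_AE ?ltW//; split=> [k|i] _.
      exact: (hw (inl (inl k))).
    exact: (hw (inl (inr i))).
  have Lp : 0 < lam by rewrite sqrtr_gt0 !mulr_gt0.
  have Mp : 0 < mu by rewrite sqrtr_gt0 !mulr_gt0.
  have Ls : lam ^+ 2 = 4 * N%:R * T%:R * v1 by rewrite sqr_sqrtr// !mulr_ge0// ltW.
  have Ms : mu ^+ 2 = 4 * T%:R * v2 by rewrite sqr_sqrtr// !mulr_ge0// ltW.
  have sNT : Num.sqrt (N%:R * T%:R) ^+ 2 = N%:R * T%:R :> R by rewrite sqr_sqrtr// mulr_ge0.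
  have sT : Num.sqrt T%:R ^+ 2 = T%:R :> R by rewrite sqr_sqrtr.
  have L2 : (lam / Num.sqrt (N%:R * T%:R)) ^+ 2 = 4 * v1.
    by rewrite expr_div_n Ls sNT; field; rewrite !gt_eqF.
  have M2 : (mu / Num.sqrt T%:R) ^+ 2 = 4 * v2.
    by rewrite expr_div_n Ms sT; field; rewrite gt_eqF.
  apply: (@kappa2_perturb _ N T p lam mu rho _ _ _ _ _ _ _ _ tau) => //.
  + by rewrite divr_gt0// sqrtr_gt0 mulr_gt0.
  + by rewrite divr_gt0// sqrtr_gt0.
  + by rewrite L2 M2; lra.
  + by rewrite L2 M2; lra.
  apply: Gamma_Psi_close; first exact: ltW.
    by move=> j k; rewrite leNgt; apply/negP; exact: (hw (inr (inl (j, k)))).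
  by move=> i k; rewrite leNgt; apply/negP; exact: (hw (inr (inr (i, k)))).
rewrite !big_sumType /=.
have sX : \sum_k Pr (BX v1 k) <= A * (p%:R * expR (- th1)).
  apply: (@le_trans _ _ (\sum_(k < p) A * expR (- th1))).
    by apply: ler_sum => k _; exact: score_tail.
  by rewrite sumr_const card_ord -[_ *+ p]mulr_natl; lra.
have sD : \sum_i Pr (BD v2 i) <= A * (N%:R * expR (- th2)).
  apply: (@le_trans _ _ (\sum_(k < N) A * expR (- th2))).
    by apply: ler_sum => k _; exact: error_sum_tail.
  by rewrite sumr_const card_ord -[_ *+ N]mulr_natl; lra.
have sG : \sum_jk Pr (BG (N%:R * tau ^+ 2) jk) <= A * p%:R ^+ 2 * expR (- th3).
  apply: (@le_trans _ _ (\sum_(k : 'I_p * 'I_p) A * expR (- th3))).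
    by apply: ler_sum => k _; exact: gram_tail.
  rewrite sumr_const card_prod !card_ord -[_ *+ (p * p)]mulr_natl natrM expr2; lra.
have sM : \sum_ik Pr (BM (N%:R * tau ^+ 2) ik) <= A * (N%:R * p%:R) * expR (- th3).
  apply: (@le_trans _ _ (\sum_(k : 'I_N * 'I_p) A * expR (- th3))).
    by apply: ler_sum => k _; exact: covariate_mean_tail.
  rewrite sumr_const card_prod !card_ord -[_ *+ (N * p)]mulr_natl natrM; lra.
lra.
Qed.

End Panel.
End FiniteMoments.

Unset Implicit Arguments.

(** * Probability of the events and error bound of the panel Lasso *)

Theorem theorem3 (R : realType) (C K : R) (C_gt0 : 0 < C) (K_gt0 : 0 < K) :
  exists A B : R, 0 < A /\ 0 < B /\
  forall (d : measure_display) (Omega : measurableType d) (P : probability Omega R)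
    (N T p : nat)
    (x : 'I_N -> 'I_T -> 'I_p -> {RV P >-> R})
    (eps : 'I_N -> 'I_T -> {RV P >-> R})
    (y : 'I_N -> 'I_T -> Omega -> R)
    (beta : 'cV[R]_p) (c : 'cV[R]_N) (a : nat -> nat -> R),
  expR 1 <= p%:R :> R -> expR 1 <= N%:R :> R -> (0 < T)%N ->
  (forall i t w, y i t w = \sum_k x i t k w * beta k 0 + c i 0 + eps i t w) ->
  assumption_A1 x eps ->
  assumption_A2b x eps C K ->
  (forall n m, expR 1 <= a n m) ->
  let s1 := sparsity beta in
  let s2 := sparsity c in
  let logp : R := ln p%:R in
  let logN : R := ln N%:R in
  let loga : R := ln (a N T) in
  let lam := Num.sqrt (4 * N%:R * T%:R * logp ^+ 3 * loga ^+ 3) in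
  let mu := Num.sqrt (4 * T%:R * logN ^+ 3 * loga ^+ 3) in
  let kap2 := kappa2 T lam mu (Gamma_mx x) s1 s2 in
  let t := kap2 / ((s1 + s2)%:R * Num.max (logp / logN) (logN / logp) ^+ 3) in
  let xi := 16 * loga `^ (3 / 2)
              * (logp `^ (3 / 2) * Num.sqrt s1%:R + logN `^ (3 / 2) * Num.sqrt s2%:R)
              / kap2 in
  let AB := event_A x eps lam mu `&` event_B x lam mu s1 s2 in
  0 < kap2 ->
  1 <= N%:R * t ^+ 2 ->
  ((1 - A * p%:R `^ (1 - B * loga) - A * N%:R `^ (1 - B * loga)
      - A * (p%:R ^+ 2 + N%:R * p%:R) * expR (- (B * (t ^+ 2 * N%:R) `^ (3^-1))))%:E
    <= P AB)%E
  /\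
  (forall w, AB w -> forall (bhat : 'cV[R]_p) (chat : 'cV[R]_N),
     is_panel_lasso lam mu (x_at x w) (fun i t => y i t w) bhat chat ->
     l2norm (bhat - beta) <= xi / Num.sqrt (N%:R * T%:R)
     /\ l2norm (chat - c) <= xi / Num.sqrt T%:R).

Proof.
(* The threshold of the tail bounds is v >= eH th^3; as eH >= 1, the choice
   b = 1 / eH satisfies eH b^3 <= 1. *)
pose eH : R := expR 1 * tail_scale C.
have scale1 : 1 <= tail_scale C.
  rewrite /tail_scale mulr_ege1 ?sum_moment_cst_ge1// exprn_ege1// lerDl divr_ge0// ltW//.
have eH1 : 1 <= eH by rewrite mulr_ege1// -[leLHS]expR0 ler_expR.
have eH0 : 0 < eH by exact: lt_le_trans eH1.
pose b : R := eH^-1.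
have b0 : 0 < b by rewrite invr_gt0.
have b1 : b <= 1 by rewrite invf_le1.
have eHb : eH * b ^+ 3 <= 1.
  rewrite exprS mulrA mulfV ?gt_eqF// mul1r exprn_ile1// ltW//.
(* The rate b would do for the noise terms.  The entries of the Gram matrix
   have threshold N (t / 32)^2, which requires eH B^3 <= 1 / 32^2 = 1 / 1024;
   b / 16 works, its cube being b^3 / 4096. *)
exists (tail_cst K * expR 1), (b / 16); split.
  rewrite mulr_gt0 ?expR_gt0// /tail_cst mulr_gt0//.
  exact: lt_le_trans (subgaussian_cst_ge1 K_gt0).
split; first by rewrite divr_gt0.
move=> d Omega P N T p x eps y beta c a hp hN T0 hy hA1 hA2 ha.
move=> s1 s2 logp logN loga lam mu kap2 t xi AB kap0 hNt.
have e0 : 0 < expR 1 :> R by exact: expR_gt0.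
have Np : 0 < N%:R :> R by exact: lt_le_trans hN.
have pp : 0 < p%:R :> R by exact: lt_le_trans hp.
have Tp : 0 < T%:R :> R by rewrite ltr0n.
have N0 : (0 < N)%N by rewrite -(ltr0n R).
have log1 (z : R) : expR 1 <= z -> 1 <= ln z.
  by move=> hz; rewrite -[leLHS](expRK 1) ler_ln ?posrE// (lt_le_trans e0).
have lp1 : 1 <= logp by exact: log1.
have lN1 : 1 <= logN by exact: log1.
have la1 : 1 <= loga by exact: log1.
have lp0 : 0 < logp by exact: lt_le_trans lp1.
have lN0 : 0 < logN by exact: lt_le_trans lN1.
have la0 : 0 < loga by exact: lt_le_trans la1.
pose v1 := logp ^+ 3 * loga ^+ 3; pose v2 := logN ^+ 3 * loga ^+ 3.
have v10 : 0 < v1 by rewrite mulr_gt0 ?exprn_gt0.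
have v20 : 0 < v2 by rewrite mulr_gt0 ?exprn_gt0.
have lamE : lam = Num.sqrt (4 * N%:R * T%:R * v1) by rewrite /lam /v1 mulrA.
have muE : mu = Num.sqrt (4 * T%:R * v2) by rewrite /mu /v2 mulrA.
pose rho : R := Num.max (logp / logN) (logN / logp) ^+ 3.
have tE : t = kap2 / ((s1 + s2)%:R * rho) by [].
have mx0 : 0 < Num.max (logp / logN) (logN / logp).
  by rewrite lt_max divr_gt0.
have rho0 : 0 < rho by rewrite exprn_gt0.
have rho_v (l m : R) : 0 < l -> 0 < m -> l / m <= Num.max (logp / logN) (logN / logp) ->
    l ^+ 3 * loga ^+ 3 <= rho * (m ^+ 3 * loga ^+ 3).
  move=> l0 m0 h; rewrite mulrA ler_wpM2r ?exprn_ge0 ?(ltW la0)// -exprMn.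
  rewrite lerXn2r ?nnegrE ?mulr_ge0 ?(ltW l0) ?(ltW m0) ?(ltW mx0)//.
  by rewrite -ler_pdivrMr.
have s0 : (0 < s1 + s2)%N.
  rewrite lt0n; apply/negP => /eqP s0; move: hNt.
  by rewrite tE s0 mul0r invr0 mulr0 expr0n mulr0 ler10.
have s0' : 0 < (s1 + s2)%:R :> R by rewrite ltr0n.
have t0 : 0 < t by rewrite tE divr_gt0// mulr_gt0.
split.
  pose cub := (t ^+ 2 * N%:R) `^ (3^-1).
  have cub3 : cub ^+ 3 = t ^+ 2 * N%:R.
    rewrite -powR_mulrn ?powR_ge0// -powRrM mulVf ?pnatr_eq0// powRr1//.
    by rewrite mulr_ge0 ?sqr_ge0.
  have cub0 : 0 <= cub by exact: powR_ge0.
  have logs0 (l : R) : 0 < l -> 0 <= b * (l * loga).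
    by move=> l0; rewrite !mulr_ge0 ?(ltW b0) ?(ltW l0) ?(ltW la0).
  have th (l : R) : 0 < l -> eH * (b * (l * loga)) ^+ 3 <= l ^+ 3 * loga ^+ 3.
    move=> l0; rewrite exprMn mulrA [(l * loga) ^+ 3]exprMn.
    by rewrite ler_piMl// mulr_ge0 ?exprn_ge0 ?(ltW l0) ?(ltW la0).
  have := @event_probability d Omega R P N T p x eps C K C_gt0 K_gt0 N0 T0 hA1 hA2
    v1 v2 (b * (logp * loga)) (b * (logN * loga)) (b / 16 * cub) (t / 32) rho s1 s2.
  rewrite -lamE -muE -/kap2 => /(_ v10 v20 _ (logs0 _ lp0) (logs0 _ lN0)).
  move=> h; apply: le_trans (h _ _ (th _ lp0) (th _ lN0) _ _ _ kap0 _).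
  - rewrite lee_fin; set A := tail_cst K * expR 1.
    have A0 : 0 <= A.
      rewrite mulr_ge0 ?expR_ge0// /tail_cst mulr_ge0//.
      exact: le_trans (subgaussian_cst_ge1 K_gt0).
    have pw (n : R) : 0 < n -> 1 <= ln n ->
        A * (n * expR (- (b * (ln n * loga)))) <= A * n `^ (1 - b / 16 * loga).
      move=> n0 ln1; rewrite ler_wpM2l// /powR gt_eqF// -{1}(lnK n0) -expRD ler_expR.
      have h1 : 0 <= b * (ln n * loga) by apply: logs0; exact: lt_le_trans ln1.
      rewrite (_ : (1 - b / 16 * loga) * ln n = ln n - b * (ln n * loga) / 16); last by ring.
      lra.
    have := pw _ pp lp1; have := pw _ Np lN1.
    rewrite -/logp -/logN (_ : expR (- (b / 16 * cub)) = expR (- (b / 16 * (t ^+ 2 * N%:R) `^ 3^-1)))//.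
    lra.
  - by rewrite divr_gt0.
  - by rewrite mulr_ge0// divr_ge0// ltW.
  - rewrite -/eH exprMn cub3 mulrA.
    have -> : eH * (b / 16) ^+ 3 = (eH * b ^+ 3) / 4096.
      by rewrite expr_div_n mulrA (_ : 16 ^+ 3 = 4096 :> R)//; ring.
    have -> : N%:R * (t / 32) ^+ 2 = t ^+ 2 * N%:R / 1024.
      by rewrite expr_div_n (_ : 32 ^+ 2 = 1024 :> R); ring.
    have z0 : 0 <= t ^+ 2 * N%:R by rewrite mulr_ge0// sqr_ge0.
    have := ler_wpM2r z0 eHb; lra.
  - by apply: rho_v => //; rewrite le_max lexx.
  - by apply: rho_v => //; rewrite le_max lexx orbT.
  - rewrite le_eqVlt; apply/orP; left; apply/eqP; rewrite tE.
    (* With entries within t / 32 the quadratic form moves by 16 / 32 of kap2 / rho. *)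
    have frac (u s r : R) : s != 0 -> r != 0 -> u / (s * r) / 32 * (16 * r * s) = u / 2.
      by move=> sn0 rn0; field; rewrite sn0 rn0.
    by apply: frac; rewrite gt_eqF.
move=> w [hA hB] bhat chat hl.
have hlam : 0 < lam by rewrite lamE sqrtr_gt0 !mulr_gt0.
have hmu : 0 < mu by rewrite muE sqrtr_gt0 !mulr_gt0.
have [hA1' hA2'] := hA.
(* Here lam / sqrt (N T) and mu / sqrt T are 2 log(a)^(3/2) times log(p)^(3/2)
   and log(N)^(3/2), so the bound holds with 12 in place of 16. *)
have := @lasso_bound R N T p lam mu kap2 (x_at x w) (fun i t => y i t w) (eps_at eps w)
  beta bhat c chat N0 T0 hlam hmu kap0 (fun i t => hy i t w) hA1' hA2' hB hl.
rewrite -/s1 -/s2; set D := 6 * _ / _ => -[h1 h2].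
suff Dxi : D <= xi.
  by split; [apply: (le_trans h1)|apply: (le_trans h2)];
    rewrite ler_wpM2r// invr_ge0 sqrtr_ge0.
have p32 (l : R) : 0 < l -> l `^ (3 / 2) = Num.sqrt (l ^+ 3).
  move=> l0; rewrite powRrM powR12_sqrt ?powR_ge0// -powR_mulrn// ltW//.
have sN : Num.sqrt (N%:R * T%:R) != 0 :> R by rewrite gt_eqF// sqrtr_gt0 mulr_gt0.
have sT : Num.sqrt T%:R != 0 :> R by rewrite gt_eqF// sqrtr_gt0.
have s4 : Num.sqrt 4 = 2 :> R.
  by rewrite (_ : 4 = 2 ^+ 2); [rewrite sqrtr_sqr ger0_norm|ring].
have E1 : lam / Num.sqrt (N%:R * T%:R) = 2 * loga `^ (3 / 2) * logp `^ (3 / 2).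
  rewrite lamE (_ : 4 * N%:R * T%:R * v1 = 4 * (v1 * (N%:R * T%:R))); last by ring.
  rewrite [Num.sqrt (4 * _)]sqrtrM// s4 [Num.sqrt (v1 * _)]sqrtrM ?(ltW v10)// mulrA mulfK// !p32// /v1 sqrtrM ?exprn_ge0 ?(ltW lp0)//.
  by ring.
have E2 : mu / Num.sqrt T%:R = 2 * loga `^ (3 / 2) * logN `^ (3 / 2).
  rewrite muE (_ : 4 * T%:R * v2 = 4 * (v2 * T%:R)); last by ring.
  rewrite [Num.sqrt (4 * _)]sqrtrM// s4 [Num.sqrt (v2 * _)]sqrtrM ?(ltW v20)// mulrA mulfK// !p32// /v2 sqrtrM ?exprn_ge0 ?(ltW lN0)//.
  by ring.
rewrite /D /xi E1 E2 ler_wpM2r ?invr_ge0 ?(ltW kap0)//.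
set z := loga `^ (3 / 2) * (logp `^ (3 / 2) * Num.sqrt s1%:R + logN `^ (3 / 2) * Num.sqrt s2%:R).
have z0 : 0 <= z by rewrite mulr_ge0 ?addr_ge0 ?mulr_ge0 ?powR_ge0 ?sqrtr_ge0.
rewrite (_ : 6 * _ = 12 * z); last by rewrite /z; ring.
by rewrite -mulrA -/z; lra.
Qed.
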